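(* Let $$\gamma_\varepsilon= 16 \left(\delta_P^{-1}\max\left( \frac{8L}{\varepsilon},1\right)^d\right) \frac{\Lambda_P^2}{\lambda_P^2}\,\frac{\bigl(\lceil 8L\,\mathrm{diam}(\Omega)/\varepsilon \rceil\bigr)^{d+2}}{\inf_{y\in\Omega'} Q\bigl(B_{\frac{\varepsilon}{8L}}(y)\bigr)}.$$ For every $(f,g)\in L^\infty(\Omega)\times L^\infty(\Omega')$, we have the error bound $$\|f\oplus g-f_*\oplus g_*\|_{L^2(P\otimes Q)} \leq \gamma_{\varepsilon}\max\bigl(\|f\oplus g-f_*\oplus g_*\|_{\infty} , \varepsilon\bigr) \,\|\mathrm{D}\Gamma(f,g)\|_{L^2(P)\times L^2(Q)}$$ and the Polyak--Łojasiewicz inequality $$\|\mathrm{D}\Gamma (f,g)\|_{L^{2}(P) \times L^{2}(Q)}^{2} \geq \frac{1}{\gamma_\varepsilon \max\left(\|f\oplus g - f_*\oplus g_*\|_\infty,\varepsilon\right) }\big(\mathrm{QOT}_\varepsilon(P,Q)- \Gamma (f,g) \big).$$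
   Context: Fix $d\ge 1$ and $\varepsilon>0$. $B_r(x)\subset\mathbb{R}^d$ is the open ball of center $x$ and radius $r>0$. $P$ and $Q$ are probability measures on $\mathbb{R}^d$ such that: $P$ has convex, compact support $\Omega$ and a density $\rho=dP/d\mathcal{L}_d$ with respect to Lebesgue measure $\mathcal{L}_d$ with $\lambda_P\le\rho(x)\le\Lambda_P$ for all $x\in\Omega$, for constants $0<\lambda_P<\Lambda_P<\infty$; $Q$ has compact support $\Omega'$. The cost $c:\mathbb{R}^d\times\mathbb{R}^d\to\mathbb{R}$ is Lipschitz with constant $L>0$. $\delta_P\in(0,1]$ is a constant (it exists and depends only on $\Omega$ and $\lambda_P$) such that $P(B_r(x))\ge\delta_P\min(r^d,1)$ for all $r>0$, $x\in\Omega$. Quadratically regularized optimal transport (QOT): with $\Pi(P,Q)$ the set of couplings of $(P,Q)$, $$\mathrm{QOT}_\varepsilon(P,Q):=\inf_{\pi\in\Pi(P,Q)}\int c\,d\pi+\frac{\varepsilon}{2}\left\|\frac{d\pi}{d(P\otimes Q)}\right\|^2_{L^2(P\otimes Q)},$$ the last term being $+\infty$ if $\pi\not\ll P\otimes Q$. The dual objective $\Gamma:L^2(P)\times L^2(Q)\to\mathbb{R}$ is $$\Gamma(f,g):=\int\Big(f(x)+g(y)-\frac{1}{2\varepsilon}\big(f(x)+g(y)-c(x,y)\big)_+^2\Big)\,d(P\otimes Q)(x,y),$$ where $(t)_+=\max(t,0)$. Its gradient is $\mathrm{D}\Gamma(f,g)=(\mathrm{D}_1\Gamma(f,g),\mathrm{D}_2\Gamma(f,g))\in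 L^2(P)\times L^2(Q)$ with $$\mathrm{D}_1\Gamma(f,g)(x)=1-\frac1\varepsilon\int (f(x)+g(y)-c(x,y))_+\,dQ(y),\qquad \mathrm{D}_2\Gamma(f,g)(y)=1-\frac1\varepsilon\int (f(x)+g(y)-c(x,y))_+\,dP(x).$$ The norm on the product is $\|(u,v)\|^2_{L^2(P)\times L^2(Q)}=\|u\|^2_{L^2(P)}+\|v\|^2_{L^2(Q)}$. Write $(f\oplus g)(x,y):=f(x)+g(y)$. Known facts: strong duality $\mathrm{QOT}_\varepsilon(P,Q)=\sup_{L^2(P)\times L^2(Q)}\Gamma$ holds; maximizers of $\Gamma$ exist and are unique up to $(f_*+a,g_*-a)$, $a\in\mathbb{R}$. The potentials $(f_*,g_* )$ are a fixed (arbitrary) maximizer, with versions $f_*:\Omega\to\mathbb{R}$, $g_*:\Omega'\to\mathbb{R}$ that are $L$-Lipschitz; they satisfy $\int (f_*(x)+g_*(y)-c(x,y))_+dQ(y)=\varepsilon$ for all $x\in\Omega$ and $\int (f_*(x)+g_*(y)-c(x,y))_+dP(x)=\varepsilon$ for all $y\in\Omega'$. $L^\infty(\Omega)$, $L^\infty(\Omega')$ are the spaces of bounded measurable functions, and $\|\cdot\|_\infty$ is the sup norm (on $\Omega$, $\Omega'$ or $\Omega\times\Omega'$). *)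

(* Defs.v *)
From HB Require Import structures.
From mathcomp Require Import all_boot all_order all_algebra.
From mathcomp Require Import all_classical all_reals all_analysis.
From mathcomp Require Import measurable_realfun.
Set Implicit Arguments.
Unset Strict Implicit.
Unset Printing Implicit Defensive.
Import Order.TTheory GRing.Theory Num.Theory.
Import numFieldNormedType.Exports.
Local Open Scope classical_set_scope.
Local Open Scope ring_scope.

(* Matrices, hence the row vectors 'rV[R]_d that model R^d, carry the Borel
   sigma-algebra of their (product) topology. *)
Section borel_matrix.
Context {R : realType} (m n : nat).
Let G : set (set 'M[R]_(m, n)) := open.

HB.instance Definition _ := @isMeasurable.Build (sigma_display G)
  'M[R]_(m, n) <<s G >> (@sigma_algebra0 _ setT G) (@sigma_algebraC _ G)
  (@sigma_algebra_bigcup _ setT G).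

Lemma measurable_matrixE :
  (measurable : set (set 'M[R]_(m, n))) = <<s open >>.
Proof. by []. Qed.

Lemma open_measurable_matrix (U : set 'M[R]_(m, n)) : open U -> measurable U.
Proof. by move=> oU; exact: sub_sigma_algebra. Qed.

Lemma measurable_coord (i : 'I_m) (j : 'I_n) :
  measurable_fun setT (fun x : 'M[R]_(m, n) => x i j).
Proof.
apply: (measurability _ (RGenOpens.measurableE R)) => _ [_ [a [b ->] <-]].
rewrite setTI; apply: open_measurable_matrix.
apply: open_comp; last exact: interval_open.
by move=> x _; exact: coord_continuous.
Qed.

Lemma measurable_fun_matrix d (T : measurableType d) (f : T -> 'M[R]_(m, n)) :
  (forall i j, measurable_fun setT (fun x => f x i j)) -> measurable_fun setT f.
Proof.
move=> mf; apply: (measurability _ measurable_matrixE) => _ [U oU <-].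
rewrite setTI.
pose q2r (q : 'M[rat]_(m, n)) : 'M[R]_(m, n) := map_mx ratr q.
pose rad (k : nat) : R := k.+1%:R^-1.
pose I := [set qk : 'M[rat]_(m, n) * nat | ball (q2r qk.1) (rad qk.2) `<=` U].
have -> : f @^-1` U = \bigcup_(qk in I) (f @^-1` ball (q2r qk.1) (rad qk.2)).
  apply/seteqP; split => [t/= Ut|t [qk/= Iqk /Iqk//]].
  move: oU; rewrite openE => /(_ _ Ut); rewrite /interior -nbhs_ballE/=.
  move=> [e/= e0 eU].
  have [k ke] : exists k, rad k < e / 2.
    have e20 : 0 < e / 2 by rewrite divr_gt0.
    exists (Num.truncn (e / 2)^-1); rewrite /rad invf_plt ?posrE//.
    by have := truncnS_gt (e / 2)^-1.
  have rad0 : 0 < rad k by rewrite invr_gt0.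
  have q i j : {q : rat | ball (f t i j) (rad k) (ratr q)}.
    apply: cid.
    have : f t i j - rad k < f t i j + rad k.
      by rewrite ltrD2l (lt_trans _ rad0)// oppr_lt0.
    move=> /rat_in_itvoo[q]; rewrite in_itv/= => qk.
    by exists q; rewrite ball_itv/= in_itv.
  exists (\matrix_(i, j) sval (q i j), k) => /=; last first.
    split => // i j; apply: ball_sym; rewrite !mxE; exact: svalP (q i j).
  move=> /= y yball; apply: eU => /=.
  apply: (@le_ball _ _ _ (rad k + rad k)).
    by rewrite (splitr e) lerD// ltW.
  apply: ball_triangle yball; split => // i j.
  by rewrite !mxE; exact: svalP (q i j).
rewrite bigcup_mkcond; apply: countable_bigcupT_measurable => // qk.
case: ifPn => // _.
rewrite [X in measurable X](_ : _ = \bigcap_(ij in [set: 'I_m * 'I_n])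
      ((fun x => f x ij.1 ij.2) @^-1` ball (q2r qk.1 ij.1 ij.2) (rad qk.2))).
    apply: fin_bigcap_measurable => // ij _.
    rewrite -[X in measurable X]setTI; apply: mf => //.
    exact: measurable_ball.
  apply/seteqP; split => [t/= [_ H] [i j] _ /=|t/= H]; first exact: H.
  by split; [rewrite invr_gt0|move=> i j; exact: (H (i, j))].
Qed.
End borel_matrix.

Section lebesgue_rV.
Context {R : realType}.
Local Open Scope ereal_scope.

(* Lebesgue measure on R^n: the dirac mass on the one-point space R^0, then the
   image of L_1 \x L_n under the identification of R * R^n with R^(n+1). *)
Definition rVcons n (p : R * 'rV[R]_n) : 'rV[R]_n.+1 :=
  row_mx (const_mx p.1 : 'rV[R]_1) p.2.

Fixpoint lebesgue_rV n : set 'rV[R]_n -> \bar R :=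
  match n with
  | 0 => dirac (0%R : 'rV[R]_0)
  | n'.+1 => pushforward (@lebesgue_measure R \x @lebesgue_rV n') (@rVcons n')
  end.

Let rVuncons n (x : 'rV[R]_n.+1) : R * 'rV[R]_n :=
  (x ord0 ord0, rsubmx (x : 'rV[R]_(1 + n))).

Let rVconsK n : cancel (@rVcons n) (@rVuncons n).
Proof.
move=> [x v]; rewrite /rVuncons /rVcons row_mxKr; congr (_, _).
have -> : (ord0 : 'I_n.+1) = lshift n (ord0 : 'I_1) by apply/val_inj.
exact: etrans (@row_mxEl _ 1 1 n _ _ _ ord0) (mxE _ _ _ _).
Qed.

Let measurable_rVcons n : measurable_fun setT (@rVcons n).
Proof.
apply: measurable_fun_matrix => i j; rewrite [i]ord1.
case: (@split_ordP 1 n j) => k ->.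
  rewrite [X in measurable_fun _ X](_ : _ = fst) //.
  apply/funext => -[x v].
  exact: etrans (@row_mxEl _ 1 1 n _ _ _ k) (mxE _ _ _ _).
rewrite [X in measurable_fun _ X](_ : _ = (fun v : 'rV[R]_n => v ord0 k) \o snd).
  by apply: measurableT_comp => //; exact: measurable_coord.
by apply/funext => -[x v]; exact: (@row_mxEr _ 1 1 n).
Qed.

Let measurable_rVuncons n : measurable_fun setT (@rVuncons n).
Proof.
apply/measurable_fun_pairP; split; first exact: measurable_coord.
apply: measurable_fun_matrix => i j.
rewrite [X in measurable_fun _ X](_ : _ =
  (fun v : 'rV[R]_n.+1 => v i (rshift 1 j))); first exact: measurable_coord.
by apply/funext => x; rewrite /= mxE.
Qed.

Let mk_sigma_finite_measure n (nu : set 'rV[R]_n -> \bar R) :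
    nu set0 = 0 -> (forall A, 0 <= nu A) -> semi_sigma_additive nu ->
    sigma_finite setT nu ->
  exists mu : {sigma_finite_measure set 'rV[R]_n -> \bar R}, nu = mu.
Proof.
move=> nu0 nu_ge0 nu_add nu_sf.
pose nuM : {measure set 'rV[R]_n -> \bar R} :=
  HB.pack nu (isMeasure.Build _ _ _ nu nu0 nu_ge0 nu_add).
pose nuS : {sigma_finite_measure set 'rV[R]_n -> \bar R} :=
  HB.pack nu nuM (isSFinite.Build _ _ _ nu
    (@sfinite_measure_sigma_finite _ _ _ nuM nu_sf))
    (isSigmaFinite.Build _ _ _ nu nu_sf).
by exists nuS.
Qed.

Let lebesgue_rV_sigma_finite_measure n :
  exists mu : {sigma_finite_measure set 'rV[R]_n -> \bar R},
    lebesgue_rV (n:=n) = mu.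
Proof.
elim: n => [|n [mu muE]]; first by exists (dirac (0%R : 'rV[R]_0)).
rewrite /= muE.
pose f := @rVcons n; pose nu := pushforward (@lebesgue_measure R \x mu) f.
have mf A : measurable A -> measurable (f @^-1` A).
  by move=> mA; rewrite -[X in measurable X]setTI; exact: measurable_rVcons.
have nu0 : nu set0 = 0 by rewrite /nu /pushforward preimage_set0 measure0.
have nu_ge0 A : 0 <= nu A by apply: integral_ge0 => x _; exact: measure_ge0.
have nu_add : semi_sigma_additive nu.
  move=> F mF tF mUF; rewrite /nu /pushforward preimage_bigcup.
  apply: measure_semi_sigma_additive; [by move=> k; exact: mf| |].
  - apply/trivIsetP => i j _ _ ij; rewrite -preimage_setI.
    by move/trivIsetP : tF => -> //; rewrite preimage_set0.
  - by rewrite -preimage_bigcup; exact: mf.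
have nu_sf : sigma_finite setT nu.
  have /sigma_finiteP[F [FT ndF Foo]] := sigma_finiteT (@lebesgue_measure R).
  have /sigma_finiteP[G [GT ndG Goo]] := sigma_finiteT mu.
  exists (fun k => @rVuncons n @^-1` (F k `*` G k)).
    rewrite -preimage_bigcup (_ : \bigcup_k _ = setT) ?preimage_setT//.
    apply/seteqP; split => // -[x v] _.
    have [k _ Fkx] : (\bigcup_k F k) x by rewrite -FT.
    have [l _ Glv] : (\bigcup_k G k) v by rewrite -GT.
    exists (maxn k l) => //; split => /=.
      by move: x Fkx; exact/subsetPset/ndF/leq_maxl.
    by move: v Glv; exact/subsetPset/ndG/leq_maxr.
  move=> k; have [mF Fk] := Foo k; have [mG Gk] := Goo k; split.
    rewrite -[X in measurable X]setTI; apply: measurable_rVuncons => //.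
    exact: measurableX.
  rewrite /nu /pushforward -comp_preimage.
  rewrite [_ \o _](_ : _ = id); last by apply/funext => x; exact: rVconsK.
  by rewrite preimage_id product_measure1E// lte_mul_pinfty// ge0_fin_numE.
exact: mk_sigma_finite_measure.
Qed.

Let lebesgue_rV0 n : @lebesgue_rV n set0 = 0.
Proof. by have [mu ->] := lebesgue_rV_sigma_finite_measure n. Qed.

Let lebesgue_rV_ge0 n A : 0 <= @lebesgue_rV n A.
Proof. by have [mu ->] := lebesgue_rV_sigma_finite_measure n. Qed.

Let lebesgue_rV_sigma_additive n : semi_sigma_additive (@lebesgue_rV n).
Proof.
have [mu ->] := lebesgue_rV_sigma_finite_measure n.
exact: measure_semi_sigma_additive.
Qed.

HB.instance Definition _ n := isMeasure.Build _ _ _ (@lebesgue_rV n)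
  (@lebesgue_rV0 n) (@lebesgue_rV_ge0 n) (@lebesgue_rV_sigma_additive n).

Let lebesgue_rV_sigma_finite n : sigma_finite setT (@lebesgue_rV n).
Proof.
by have [mu ->] := lebesgue_rV_sigma_finite_measure n; exact: sigma_finiteT.
Qed.

HB.instance Definition _ n := Measure_isSigmaFinite.Build _ _ _ (@lebesgue_rV n)
  (@lebesgue_rV_sigma_finite n).

Lemma lebesgue_rV_box n (A : 'I_n -> set R) : (forall i, measurable (A i)) ->
  lebesgue_rV [set x : 'rV[R]_n | forall i, A i (x 0%R i)] =
  \prod_(i < n) lebesgue_measure (A i).
Proof.
elim: n A => [A _|n IH A mA].
  by rewrite big_ord0 /= diracE mem_set// => -[].
pose B : set 'rV[R]_n := [set x | forall i, A (lift ord0 i) (x 0%R i)].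
have mB : measurable B.
  rewrite [B](_ : _ = \bigcap_(i in [set: 'I_n])
    ((fun x : 'rV[R]_n => x 0%R i) @^-1` A (lift ord0 i))).
    apply: fin_bigcap_measurable => // i _.
    by rewrite -[X in measurable X]setTI; exact: measurable_coord.
  by apply/seteqP; split => x Bx i //=; exact: Bx.
rewrite big_ord_recl -IH// -product_measure1E//; last exact: mA.
apply: (congr1 (lebesgue_measure \x lebesgue_rV (n:=n))).
have rVcons0 x (v : 'rV[R]_n) : rVcons (x, v) 0%R ord0 = x :> R.
  exact: (congr1 fst (rVconsK (x, v))).
have rVconsS x (v : 'rV[R]_n) (i : 'I_n) : 
    rVcons (x, v) 0%R (lift ord0 i) = v 0%R i :> R.
  have -> : lift ord0 i = @rshift 1 n i by exact/val_inj.
  exact: (@row_mxEr R 1 1 n).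
apply/seteqP; split => -[x v] /=.
  move=> H; split; first by rewrite -(rVcons0 x v); exact: H.
  by move=> i; rewrite -(rVconsS x v i); exact: H.
move=> [Ax Bv] i; case: (unliftP ord0 i) => [j|] ->.
  by rewrite rVconsS; exact: Bv.
by rewrite rVcons0.
Qed.

End lebesgue_rV.

Section euclidean.
Context {R : realType} {d : nat}.
Implicit Types (x y : 'rV[R]_d) (S : set 'rV[R]_d).

(* The library norm of 'rV[R]_d is the max norm, which induces the same
   topology but not the same balls, diameters and Lipschitz constants. *)
Definition enorm x : R := Num.sqrt (\sum_(i < d) x 0 i ^+ 2).

Definition eball x (r : R) : set 'rV[R]_d := [set y | enorm (y - x) < r].

Definition ediam S : R := sup [set enorm (x - y) | x in S & y in S].

Definition elipschitz_on S (L : R) (f : 'rV[R]_d -> R) : Prop :=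
  forall x y, S x -> S y -> `|f x - f y| <= L * enorm (x - y).

(* Lipschitz for the Euclidean norm of R^d * R^d = R^(2d). *)
Definition elipschitz2 (L : R) (c : 'rV[R]_d -> 'rV[R]_d -> R) : Prop :=
  forall x y x' y', `|c x y - c x' y'| <=
    L * Num.sqrt (enorm (x - x') ^+ 2 + enorm (y - y') ^+ 2).

Definition is_support (mu : probability 'rV[R]_d R) S : Prop :=
  [/\ closed S, mu S = 1%E &
      forall C, closed C -> mu C = 1%E -> S `<=` C].

Definition is_lebesgue_density (mu : probability 'rV[R]_d R)
    (rho : 'rV[R]_d -> R) : Prop :=
  measurable_fun setT rho /\
  forall A, measurable A ->
    mu A = (\int[lebesgue_rV (n:=d)]_(x in A) (rho x)%:E)%E.

(* Elements of L^oo(S) are represented by functions on R^d; their values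
   outside S are irrelevant. *)
Definition bounded_measurable_on S (f : 'rV[R]_d -> R) : Prop :=
  measurable_fun setT f /\ exists M : R, forall x, S x -> `|f x| <= M.

Definition oplus (f g : 'rV[R]_d -> R) (z : 'rV[R]_d * 'rV[R]_d) : R :=
  f z.1 + g z.2.

Definition sup_norm2 S S' (h : 'rV[R]_d * 'rV[R]_d -> R) : R :=
  sup [set `|h z| | z in S `*` S'].

End euclidean.

Section qot.
Local Open Scope charge_scope.
Context {R : realType} {d : nat}.
Implicit Types (f g : 'rV[R]_d -> R) (x y : 'rV[R]_d).
Variables (P Q : probability 'rV[R]_d R) (c : 'rV[R]_d -> 'rV[R]_d -> R).
Variable eps : R.

(* The ascription makes the structure of probability measure (hence of
   sigma-finite measure) of the product available. *)
Definition prod_prob : probability ('rV[R]_d * 'rV[R]_d)%type R := (P \x Q)%E.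

Definition is_coupling (pi : probability ('rV[R]_d * 'rV[R]_d)%type R) : Prop :=
  (forall A, measurable A -> pi (A `*` setT) = P A) /\
  (forall B, measurable B -> pi (setT `*` B) = Q B).

Definition qot_objective (pi : probability ('rV[R]_d * 'rV[R]_d)%type R)
    : \bar R :=
  (\int[pi]_z (c z.1 z.2)%:E +
   if `[< pi `<< prod_prob >]
   then (eps / 2)%:E *
     'N[prod_prob]_2%:E['d (charge_of_finite_measure pi) '/d prod_prob] ^+ 2
   else +oo)%E.

Definition QOT : \bar R := ereal_inf (qot_objective @` is_coupling).

Definition dual_obj f g : \bar R :=
  (\int[prod_prob]_z
    (oplus f g z - (2 * eps)^-1 * Num.max (oplus f g z - c z.1 z.2) 0 ^+ 2)%:E)%E.

Definition D1 f g x : R :=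
  1 - eps^-1 * \int[Q]_y Num.max (f x + g y - c x y) 0.

Definition D2 f g y : R :=
  1 - eps^-1 * \int[P]_x Num.max (f x + g y - c x y) 0.

Definition grad_norm f g : \bar R :=
  sqrte ('N[P]_2%:E[EFin \o D1 f g] ^+ 2 + 'N[Q]_2%:E[EFin \o D2 f g] ^+ 2)%E.

Definition is_dual_maximizer f g : Prop :=
  [/\ f \in Lfun P 2%:E, g \in Lfun Q 2%:E &
      forall f' g', f' \in Lfun P 2%:E -> g' \in Lfun Q 2%:E ->
        (dual_obj f' g' <= dual_obj f g)%E].

Definition gamma (L lambdaP LambdaP deltaP : R) (Omega Omega' : set 'rV[R]_d)
    : R :=
  16 * (deltaP^-1 * Num.max (8 * L / eps) 1 ^+ d) *
  (LambdaP ^+ 2 / lambdaP ^+ 2) *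
  ((Num.ceil (8 * L * ediam Omega / eps))%:~R ^+ (d + 2) /
   inf [set fine (Q (eball y (eps / (8 * L)))) | y in Omega']).

End qot.

(* Main.v *)
Require Import Defs.
From HB Require Import structures.
From mathcomp Require Import all_boot all_order all_algebra.
From mathcomp Require Import finmap.
From mathcomp Require Import all_classical all_reals all_analysis.
From mathcomp Require Import measurable_realfun ring lra.
Import Order.TTheory GRing.Theory Num.Theory.
Import numFieldNormedType.Exports.
Local Open Scope classical_set_scope.
Local Open Scope ring_scope.
Set Implicit Arguments.
Unset Strict Implicit.
Unset Printing Implicit Defensive.

(** Write u = f - fs, v = g - gs, h = u (+) v and xi = fs (+) gs - c. The proof
    restricts all functions to the supports, where they are bounded, and rests on
    a growth property of the dual objective around its maximisers.

    Maximality of (fs, gs) says that the gradient of the dual objective vanishes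
    there ([grad1_eq0], [grad2_eq0]), i.e. that xi_+ has mean eps in each
    variable. Hence pairing the gradient at (f, g) with (u, v) gives minus the
    mean of ((xi + h)_+ - xi_+) h / eps. This integrand is nonnegative, and on the
    region A where xi is at least eps / 2 it is at least h^2 / (2 M), M being the
    maximum of eps and of the sup norm of h ([growth_pairing]). It remains to
    control the mean of h^2 by its mean over A, and this is where the additive
    structure of h and the geometry come in ([additive_poincare]).

    As xi_+ has mean eps in each variable, almost every x has a partner y0 with
    xi (x, y0) at least eps, and conversely; by Lipschitz continuity xi is at least
    eps / 2 when both variables move by at most r = eps / (8 L). So if x and x' are
    at distance at most r, then u x - u x' = h (x, y) - h (x', y) is controlled by
    h on A, for y in a ball of mass at least q, the infimum of the masses of the
    balls of Q of radius r. For x and x' arbitrary, cut the segment from x to x',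
    which stays in the convex support of P, into N pieces of length at most r: with
    the bounds on the density and a linear change of variables for each piece
    ([lebesgue_segment], [chaining]), the variance of u is controlled up to the
    factor (LambdaP / lambdaP)^2 N^(d + 2). Finally v y = h (x, y) - u x, for x in
    a ball of mass at least p = deltaP min(r^d, 1), controls v.

    By Cauchy-Schwarz the resulting inequality, of the form
    |h|^2 <= gamma M |gradient| |h|, is the error bound. For the inequality on the
    values, the plan of density xi_+ / eps is a coupling whose cost is the maximal
    dual value ([QOT_le_dualR]), so that concavity bounds the gap by
    |gradient| |h|, to which the error bound applies. The infimum q is positive
    because the support of Q is compact ([inf_mass_gt0]), and N is positive
    because P does not charge points ([ediam_gt0]). *)

(** * Bounded measurable functions and their expectations *)

Section bounded_measurable.
Context {d : measure_display} {T : measurableType d} {R : realType}.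
Implicit Types (f g : T -> R).

(** Bounded measurable functions, on which all the analysis takes place: they
    are integrable for every probability measure, so that expectations can be
    computed as real numbers. *)
Definition bmeas f : Prop :=
  measurable_fun setT f /\ exists M : R, forall x, `|f x| <= M.

Lemma bmeas_cst (a : R) : bmeas (fun=> a).
Proof. by split; [exact: measurable_cst|exists `|a|]. Qed.

Lemma bmeasD f g : bmeas f -> bmeas g -> bmeas (fun x => f x + g x).
Proof.
move=> [mf [M fM]] [mg [N gN]]; split; first exact: measurable_funD.
by exists (M + N) => x; rewrite (le_trans (ler_normD _ _))// lerD.
Qed.

Lemma bmeasN f : bmeas f -> bmeas (fun x => - f x).
Proof.
move=> [mf [M fM]]; split; first exact: measurable_funN.
by exists M => x; rewrite normrN.
Qed.

Lemma bmeasM f g : bmeas f -> bmeas g -> bmeas (fun x => f x * g x).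
Proof.
move=> [mf [M fM]] [mg [N gN]]; split; first exact: measurable_funM.
by exists (M * N) => x; rewrite normrM ler_pM.
Qed.

Lemma bmeasX f (n : nat) : bmeas f -> bmeas (fun x => f x ^+ n).
Proof.
move=> [mf [M fM]]; split; first exact: measurable_funX.
by exists (M ^+ n) => x; rewrite normrX lerXn2r// nnegrE (le_trans _ (fM x)).
Qed.

Lemma bmeas_max0 f : bmeas f -> bmeas (fun x => Num.max (f x) 0).
Proof.
move=> [mf [M fM]]; split; first exact: measurable_maxr.
exists M => x; have M0 := le_trans (normr_ge0 _) (fM x).
by rewrite /Num.max; case: ifPn => // _; rewrite normr0.
Qed.

Lemma bmeas_indic (A : set T) : measurable A -> bmeas (fun x => \1_A x).
Proof.
move=> mA; split; first exact: measurable_indic.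
by exists 1 => x; rewrite indicE; case: (_ \in _); rewrite ?normr1 ?normr0.
Qed.

Lemma measurable_zeros f : bmeas f -> measurable [set x | f x = 0].
Proof.
move=> [mf _]; rewrite -[X in measurable X]setTI.
exact: (mf measurableT [set 0] (measurable_set1 0)).
Qed.

End bounded_measurable.

Section bounded_measurable_comp.
Context {d d' : measure_display} {T : measurableType d} {T' : measurableType d'}.
Context {R : realType}.

Lemma bmeas_comp (f : T' -> R) (phi : T -> T') :
  bmeas f -> measurable_fun setT phi -> bmeas (fun x => f (phi x)).
Proof.
move=> [mf [M fM]] mphi; split; first exact: measurableT_comp.
by exists M.
Qed.

End bounded_measurable_comp.

Section bounded_measurable_prod.
Context {d d' : measure_display} {T : measurableType d} {T' : measurableType d'}.
Context {R : realType}.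

Lemma bmeas_fst (f : T -> R) : bmeas f -> bmeas (fun z : T * T' => f z.1).
Proof. by move=> bf; exact: (bmeas_comp bf measurable_fst). Qed.

Lemma bmeas_snd (f : T' -> R) : bmeas f -> bmeas (fun z : T * T' => f z.2).
Proof. by move=> bf; exact: (bmeas_comp bf measurable_snd). Qed.

Lemma bmeas_xsec (f : T * T' -> R) (x : T) : bmeas f -> bmeas (fun y => f (x, y)).
Proof.
move=> [mf [M fM]]; split; last by exists M.
exact: (measurableT_comp mf (measurable_pair1 x)).
Qed.

Lemma bmeas_ysec (f : T * T' -> R) (y : T') : bmeas f -> bmeas (fun x => f (x, y)).
Proof.
move=> [mf [M fM]]; split; last by exists M.
exact: (measurableT_comp mf (measurable_pair2 y)).
Qed.

End bounded_measurable_prod.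

Section expectation.
Context {d : measure_display} {T : measurableType d} {R : realType}.
Variable mu : probability T R.
Implicit Types (f g : T -> R).

Lemma bmeas_integrable f : bmeas f -> mu.-integrable setT (EFin \o f).
Proof.
move=> [mf [M fM]]; apply: measurable_bounded_integrable => //.
  by rewrite (le_lt_trans (probability_le1 _ _))// ltry.
exists M; split; first by rewrite num_real.
by move=> x Mx t _ /=; rewrite (le_trans (fM t))// ltW.
Qed.

Lemma bmeas_EFin f : bmeas f ->
  (\int[mu]_x (f x)%:E = (\int[mu]_x f x)%:E)%E.
Proof.
by move=> bf; rewrite fineK// integrable_fin_num//; exact: bmeas_integrable.
Qed.

Lemma expD f g : bmeas f -> bmeas g ->
  \int[mu]_x (f x + g x) = \int[mu]_x f x + \int[mu]_x g x.
Proof. by move=> bf bg; rewrite RintegralD//; exact: bmeas_integrable. Qed.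

Lemma expZ f a : bmeas f -> \int[mu]_x (a * f x) = a * \int[mu]_x f x.
Proof. by move=> bf; rewrite RintegralZl//; exact: bmeas_integrable. Qed.

Lemma expZr f a : bmeas f -> \int[mu]_x (f x * a) = (\int[mu]_x f x) * a.
Proof. by move=> bf; rewrite RintegralZr//; exact: bmeas_integrable. Qed.

Lemma expN f : bmeas f -> \int[mu]_x (- f x) = - \int[mu]_x f x.
Proof.
by move=> bf; rewrite -mulN1r -expZ//; under eq_Rintegral do rewrite -mulN1r.
Qed.

Lemma expB f g : bmeas f -> bmeas g ->
  \int[mu]_x (f x - g x) = \int[mu]_x f x - \int[mu]_x g x.
Proof. by move=> bf bg; rewrite RintegralB//; exact: bmeas_integrable. Qed.

Lemma exp_cst a : \int[mu]_x (a : R) = a.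
Proof.
rewrite Rintegral_cst// -[RHS]mulr1; congr (_ * _).
by rewrite -[RHS]/(fine 1%E); congr fine; exact: probability_setT.
Qed.

Lemma le_exp f g : bmeas f -> bmeas g -> (forall x, f x <= g x) ->
  \int[mu]_x f x <= \int[mu]_x g x.
Proof.
by move=> bf bg fg; apply: le_Rintegral => //; exact: bmeas_integrable.
Qed.

Lemma exp_ge0 f : (forall x, 0 <= f x) -> 0 <= \int[mu]_x f x.
Proof. by move=> f0; exact: Rintegral_ge0. Qed.

Lemma eq_exp f g : f =1 g -> \int[mu]_x f x = \int[mu]_x g x.
Proof. by move=> fg; apply: eq_Rintegral => x _. Qed.

Lemma exp_indic (A : set T) : measurable A ->
  \int[mu]_x (\1_A x : R) = fine (mu A).
Proof. by move=> mA; rewrite /Rintegral integral_indic// setIT. Qed.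

Lemma ae_eq_exp (A : set T) f g : measurable A -> mu A = 1%E ->
  bmeas f -> bmeas g -> (forall x, A x -> f x = g x) ->
  \int[mu]_x f x = \int[mu]_x g x.
Proof.
move=> mA A1 bf bg fg; congr fine; apply: ae_eq_integral => //.
- by apply/measurable_EFinP; case: bf.
- by apply/measurable_EFinP; case: bg.
- exists (~` A); split; first exact: measurableC.
    by rewrite [LHS]probability_setC// A1 subee.
  by move=> x /= + Ax; apply => _; rewrite fg.
Qed.

Lemma ae_le_exp (A : set T) f g : measurable A -> mu A = 1%E ->
  bmeas f -> bmeas g -> (forall x, A x -> f x <= g x) ->
  \int[mu]_x f x <= \int[mu]_x g x.
Proof.
move=> mA A1 bf bg fg.
have bA := bmeas_indic mA (R := R).
have e h : bmeas h -> \int[mu]_x h x = \int[mu]_x (h x * \1_A x).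
  move=> bh; apply: (ae_eq_exp mA) => //; first exact: bmeasM.
  by move=> x Ax; rewrite indicE mem_set// mulr1.
rewrite e// [leRHS]e//; apply: le_exp; [exact: bmeasM..|].
move=> x; rewrite indicE; have [xA|] := boolP (x \in A); last by rewrite !mulr0.
by rewrite !mulr1; apply: fg; exact: set_mem.
Qed.

Lemma exp_eq0_ae f : bmeas f -> (forall x, 0 <= f x) -> \int[mu]_x f x = 0 ->
  mu [set x | f x = 0] = 1%E.
Proof.
move=> bf f0 If.
have mf : measurable_fun setT f by case: bf.
have m0 := measurable_zeros bf.
have : ae_eq mu setT (EFin \o f) (cst 0%E).
  apply/ae_eq_integral_abs => //; first exact/measurable_EFinP.
  under eq_integral do rewrite /= ger0_norm//.
  by rewrite bmeas_EFin// If.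
move=> /(negligibleS _) h.
have : mu (~` [set x | f x = 0]) = 0%E.
  apply/negligibleP; first exact: measurableC.
  by apply: h => x /= fx /(_ I) [].
rewrite probability_setC//.
rewrite -[mu _]fineK ?fin_num_measure// -EFinB => -[] /eqP.
by rewrite subr_eq0 => /eqP <-.
Qed.

(** The quadratic form E (s f + t g)^2 is nonnegative. *)
Lemma cauchy_schwarz f g : bmeas f -> bmeas g ->
  (\int[mu]_x (f x * g x)) ^+ 2 <=
  (\int[mu]_x (f x ^+ 2)) * \int[mu]_x (g x ^+ 2).
Proof.
move=> bf bg.
set a := \int[mu]_x (f x ^+ 2); set b := \int[mu]_x (f x * g x).
set c := \int[mu]_x (g x ^+ 2).
have a0 : 0 <= a by apply: exp_ge0 => x; exact: sqr_ge0.
have c0 : 0 <= c by apply: exp_ge0 => x; exact: sqr_ge0.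
have quad s t : 0 <= s ^+ 2 * a + 2 * s * t * b + t ^+ 2 * c.
  have -> : s ^+ 2 * a + 2 * s * t * b + t ^+ 2 * c =
      \int[mu]_x ((s * f x + t * g x) ^+ 2).
    rewrite -!expZ; [|exact: bmeasX|exact: bmeasM|exact: bmeasX].
    rewrite -!expD; [|by do ?[apply: bmeasD|apply: bmeasM|apply: bmeasX|exact: bmeas_cst]..].
    by apply: eq_exp => x; ring.
  by apply: exp_ge0 => x; exact: sqr_ge0.
have ac0 : 0 <= a * (a * c - b ^+ 2).
  by have := quad (- b) a; rewrite (_ : _ + _ = a * (a * c - b ^+ 2)); last ring.
have cc0 : 0 <= c * (a * c - b ^+ 2).
  by have := quad c (- b); rewrite (_ : _ + _ = c * (a * c - b ^+ 2)); last ring.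
rewrite -subr_ge0; have [a_gt0|a_le0] := ltP 0 a.
  by rewrite -(pmulr_rge0 _ a_gt0).
have [c_gt0|c_le0] := ltP 0 c; first by rewrite -(pmulr_rge0 _ c_gt0).
have a00 : a = 0 by lra.
have c00 : c = 0 by lra.
have := quad 1 1; have := quad 1 (-1); rewrite a00 c00 => q1 q2.
have -> : b = 0 by lra.
by rewrite expr0n /= mulr0 subr0.
Qed.

End expectation.

(** * Expectations on a product *)

Section product_expectation.
Context {d d' : measure_display} {T : measurableType d} {T' : measurableType d'}.
Context {R : realType}.

(** The product measure, as a probability measure. *)
Definition pprod (P : probability T R) (Q : probability T' R) :
  probability (T * T')%type R := (P \x Q)%E.

Variables (P : probability T R) (Q : probability T' R).
Implicit Type F : T * T' -> R.

Lemma pprod_setX A B : measurable A -> measurable B ->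
  P A = 1%E -> Q B = 1%E -> pprod P Q (A `*` B) = 1%E.
Proof.
move=> mA mB A1 B1; transitivity (P A * Q B)%E; first exact: product_measure1E.
by rewrite A1 B1 mule1.
Qed.

Lemma bmeas_exp_snd F : bmeas F -> bmeas (fun x => \int[Q]_y F (x, y)).
Proof.
move=> bF; split.
  apply: (@measurableT_comp _ _ _ _ _ _ fine) => //.
  apply: (@measurable_fubini_F _ _ T T' R P Q (EFin \o F)) => //.
  exact: (bmeas_integrable (pprod P Q)).
have [mF [M FM]] := bF; exists M => x; apply: le_trans.
  apply: le_normr_Rintegral => //; apply: bmeas_integrable; exact: bmeas_xsec.
rewrite -[leRHS](exp_cst Q); apply: le_exp => //; last exact: bmeas_cst.
split; last by exists M => y; rewrite normr_id.
by apply: measurableT_comp => //; have [] := bmeas_xsec x bF.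
Qed.

Lemma bmeas_exp_fst F : bmeas F -> bmeas (fun y => \int[P]_x F (x, y)).
Proof.
move=> bF; split.
  apply: (@measurableT_comp _ _ _ _ _ _ fine) => //.
  apply: (@measurable_fubini_G _ _ T T' R P Q (EFin \o F)) => //.
  exact: (bmeas_integrable (pprod P Q)).
have [mF [M FM]] := bF; exists M => y; apply: le_trans.
  apply: le_normr_Rintegral => //; apply: bmeas_integrable; exact: bmeas_ysec.
rewrite -[leRHS](exp_cst P); apply: le_exp => //; last exact: bmeas_cst.
split; last by exists M => x; rewrite normr_id.
by apply: measurableT_comp => //; have [] := bmeas_ysec y bF.
Qed.

Lemma exp_pprod F : bmeas F ->
  \int[pprod P Q]_z F z = \int[P]_x \int[Q]_y F (x, y).
Proof.
move=> bF; apply: EFin_inj; rewrite -bmeas_EFin// -bmeas_EFin; last exact: bmeas_exp_snd.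
rewrite -(@integral12_prod_meas1 _ _ T T' R P Q (EFin \o F)); last first.
  exact: (bmeas_integrable (pprod P Q)).
by apply: eq_integral => x _; rewrite /fubini_F/= bmeas_EFin//; exact: bmeas_xsec.
Qed.

Lemma exp_pprodC F : bmeas F ->
  \int[pprod P Q]_z F z = \int[Q]_y \int[P]_x F (x, y).
Proof.
move=> bF; apply: EFin_inj; rewrite -bmeas_EFin// -bmeas_EFin; last exact: bmeas_exp_fst.
rewrite -(@integral21_prod_meas1 _ _ T T' R P Q (EFin \o F)); last first.
  exact: (bmeas_integrable (pprod P Q)).
by apply: eq_integral => y _; rewrite /fubini_G/= bmeas_EFin//; exact: bmeas_ysec.
Qed.

Lemma exp_pprod_fst f : bmeas f -> \int[pprod P Q]_z f z.1 = \int[P]_x f x.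
Proof.
move=> bf; rewrite exp_pprod; last exact: bmeas_fst.
by apply: eq_exp => x /=; rewrite exp_cst.
Qed.

Lemma exp_pprod_snd f : bmeas f -> \int[pprod P Q]_z f z.2 = \int[Q]_x f x.
Proof.
move=> bf; rewrite exp_pprodC; last exact: bmeas_snd.
by apply: eq_exp => x /=; rewrite exp_cst.
Qed.

End product_expectation.

(** Closes goals of the form bmeas f, or reduces them to the atoms of f. *)
Ltac bmeas := repeat first
  [ assumption
  | exact: bmeas_cst
  | match goal with |- bmeas (fun x => @?f x + @?g x) => apply: (@bmeasD _ _ _ f g) end
  | match goal with |- bmeas (fun x => - @?f x) => apply: (@bmeasN _ _ _ f) end
  | match goal with |- bmeas (fun x => @?f x * @?g x) => apply: (@bmeasM _ _ _ f g) end
  | match goal with |- bmeas (fun x => @?f x ^+ ?n) => apply: (@bmeasX _ _ _ f n) end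
  | match goal with |- bmeas (fun x => Num.max (@?f x) 0) => apply: (@bmeas_max0 _ _ _ f) end
  | match goal with |- bmeas (fun z => ?f z.1) => apply: (@bmeas_fst _ _ _ _ _ f) end
  | match goal with |- bmeas (fun z => ?f z.2) => apply: (@bmeas_snd _ _ _ _ _ f) end
  | match goal with |- bmeas (fun y => ?F (?x, y)) => apply: (@bmeas_xsec _ _ _ _ _ F x) end
  | match goal with |- bmeas (fun x => ?F (x, ?y)) => apply: (@bmeas_ysec _ _ _ _ _ F y) end
  ].

(** Under the normalisation E_P u = 0 the functions u and v are orthogonal in
    L^2 of the product. *)
Lemma oplus_sqr {d d' : measure_display} {T : measurableType d}
    {T' : measurableType d'} {R : realType}
    (P : probability T R) (Q : probability T' R) (u : T -> R) (v : T' -> R) :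
  bmeas u -> bmeas v -> \int[P]_x u x = 0 ->
  \int[pprod P Q]_z ((u z.1 + v z.2) ^+ 2) =
  \int[P]_x (u x ^+ 2) + \int[Q]_y (v y ^+ 2).
Proof.
move=> bu bv u0; under eq_exp do rewrite sqrrD mulr2n.
rewrite !expD; [|by bmeas..].
rewrite -(exp_pprod_fst P Q (f := fun x => u x ^+ 2)); last by bmeas.
rewrite -(exp_pprod_snd P Q (f := fun x => v x ^+ 2)); last by bmeas.
rewrite -[X in _ = X + _]addr0; congr (_ + _ + _).
rewrite exp_pprodC; last by bmeas.
rewrite (_ : \int[Q]_y _ = 0) ?addr0//.
under eq_exp => y do [rewrite /= expZr; last by bmeas]; rewrite u0.
by under eq_exp do rewrite mul0r; rewrite exp_cst.
Qed.

(** * The dual objective and its gradient *)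

Section dual_gap.
Context {d d' : measure_display} {T : measurableType d} {T' : measurableType d'}.
Context {R : realType}.
Variables (P : probability T R) (Q : probability T' R) (eps : R).
Hypothesis eps_gt0 : 0 < eps.
Implicit Types (F xi : T * T' -> R) (u : T -> R) (v : T' -> R).

Let PQ := pprod P Q.

(** The partial gradients of the dual objective at (f, g), as functions of
    F = f (+) g - c. *)
Definition grad1 F x : R := 1 - eps^-1 * \int[Q]_y Num.max (F (x, y)) 0.
Definition grad2 F y : R := 1 - eps^-1 * \int[P]_x Num.max (F (x, y)) 0.

Lemma bmeas_grad1 F : bmeas F -> bmeas (grad1 F).
Proof.
move=> bF; rewrite /grad1; bmeas.
by apply: (@bmeas_exp_snd _ _ _ _ _ P Q (fun z => Num.max (F z) 0)); bmeas.
Qed.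

Lemma bmeas_grad2 F : bmeas F -> bmeas (grad2 F).
Proof.
move=> bF; rewrite /grad2; bmeas.
by apply: (@bmeas_exp_fst _ _ _ _ _ P Q (fun z => Num.max (F z) 0)); bmeas.
Qed.

(** The derivative of the dual objective in the direction (u, v); it depends on
    (u, v) only through u (+) v. *)
Lemma pairing F u v : bmeas F -> bmeas u -> bmeas v ->
  \int[PQ]_z ((u z.1 + v z.2) * (1 - eps^-1 * Num.max (F z) 0)) =
  \int[P]_x (u x * grad1 F x) + \int[Q]_y (v y * grad2 F y).
Proof.
move=> bF bu bv.
under eq_exp do rewrite mulrDl.
rewrite expD; [|by bmeas..]; congr (_ + _).
  rewrite exp_pprod; last by bmeas.
  apply: eq_exp => x /=; rewrite expZ; last by bmeas.
  by congr (_ * _); rewrite expB ?expZ ?exp_cst//; bmeas.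
rewrite exp_pprodC; last by bmeas.
apply: eq_exp => y /=; rewrite expZ; last by bmeas.
by congr (_ * _); rewrite expB ?expZ ?exp_cst//; bmeas.
Qed.

(** The dual objective as a function of s = f (+) g and F = f (+) g - c. *)
Definition dualR (s F : T * T' -> R) : R :=
  \int[PQ]_z (s z - (2 * eps)^-1 * Num.max (F z) 0 ^+ 2).

Lemma dualR_shift s xi h : bmeas s -> bmeas xi -> bmeas h ->
  dualR (fun z => s z + h z) (fun z => xi z + h z) - dualR s xi =
  \int[PQ]_z (h z - (2 * eps)^-1 *
    (Num.max (xi z + h z) 0 ^+ 2 - Num.max (xi z) 0 ^+ 2)).
Proof.
move=> bs bxi bh; rewrite /dualR -expB; [|by bmeas..].
by apply: eq_exp => z; ring.
Qed.

(** The square of the positive part is convex and 2-smooth: its derivative at t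
    is twice the positive part of t. *)
Lemma maxr0_convex (a b : R) :
  Num.max (a + b) 0 ^+ 2 - Num.max a 0 ^+ 2 <= 2 * b * Num.max (a + b) 0.
Proof.
rewrite /Num.max; case: ifPn => [ab|]; case: ifPn => [|]; rewrite -?leNgt => *; nra.
Qed.

Lemma maxr0_smooth (a b : R) :
  Num.max (a + b) 0 ^+ 2 - Num.max a 0 ^+ 2 <= 2 * b * Num.max a 0 + b ^+ 2.
Proof.
rewrite /Num.max; case: ifPn => [ab|]; case: ifPn => [|]; rewrite -?leNgt => *; nra.
Qed.

(** Concavity: the increment in the direction h is at least the derivative at
    the end point. *)
Lemma dualR_concave s xi h : bmeas s -> bmeas xi -> bmeas h ->
  dualR s xi - dualR (fun z => s z + h z) (fun z => xi z + h z) <=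
  - \int[PQ]_z (h z * (1 - eps^-1 * Num.max (xi z + h z) 0)).
Proof.
move=> bs bxi bh; rewrite -opprB lerN2 dualR_shift//.
apply: le_exp; [by bmeas..|] => z.
have := maxr0_convex (xi z) (h z).
set A := Num.max (xi z + h z) 0; set B := Num.max (xi z) 0 => AB.
have e0 : 0 < eps^-1 by rewrite invr_gt0.
have -> : (2 * eps)^-1 = eps^-1 / 2 by rewrite invfM mulrC.
nra.
Qed.

(** If no multiple of phi increases the dual objective, then the derivative in
    the direction phi vanishes. *)
Lemma first_order_condition s xi phi : bmeas s -> bmeas xi -> bmeas phi ->
  (forall t, dualR (fun z => s z + t * phi z) (fun z => xi z + t * phi z)
    <= dualR s xi) ->
  \int[PQ]_z (phi z * (1 - eps^-1 * Num.max (xi z) 0)) = 0.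
Proof.
move=> bs bxi bphi smax; set b := LHS.
pose q := (2 * eps)^-1 * \int[PQ]_z (phi z ^+ 2).
have q0 : 0 <= q.
  apply: mulr_ge0; first by rewrite invr_ge0 mulr_ge0// ltW.
  by apply: exp_ge0 => z; exact: sqr_ge0.
have tb t : t * b <= t ^+ 2 * q.
  rewrite -subr_ge0 -oppr_le0; have := smax t.
  rewrite -subr_le0 dualR_shift//; last by bmeas.
  apply: le_trans.
  rewrite /b /q -!expZ; [|by bmeas..].
  rewrite -expB; [|by bmeas..]; rewrite -expN; last by bmeas.
  apply: le_exp; [by bmeas..|] => z.
  have := maxr0_smooth (xi z) (t * phi z).
  set A := Num.max (xi z + _) 0; set B := Num.max (xi z) 0 => AB.
  have e0 : 0 < eps^-1 by rewrite invr_gt0.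
  have -> : (2 * eps)^-1 = eps^-1 / 2 by rewrite invfM mulrC.
  nra.
have q1 : 0 < q + 1 by lra.
(* The inequality t b <= t^2 q, for all t, forces b = 0. *)
have := tb (b / (q + 1)).
rewrite -(@ler_pM2r _ ((q + 1) ^+ 2)) ?exprn_gt0//.
have -> : b / (q + 1) * b * (q + 1) ^+ 2 = b ^+ 2 * (q + 1).
  by field; lra.
have -> : (b / (q + 1)) ^+ 2 * q * (q + 1) ^+ 2 = b ^+ 2 * q.
  by field; lra.
move=> h; apply/eqP; rewrite -sqrf_eq0 eq_le sqr_ge0 andbT; lra.
Qed.

(** At a maximiser the gradient vanishes almost everywhere: test the first order
    condition against the gradient itself. *)
Lemma grad1_eq0 s xi : bmeas s -> bmeas xi ->
  (forall u, bmeas u ->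
    dualR (fun z => s z + u z.1) (fun z => xi z + u z.1) <= dualR s xi) ->
  P [set x | grad1 xi x = 0] = 1%E.
Proof.
move=> bs bxi smax.
have bD := bmeas_grad1 bxi.
have := @first_order_condition s xi (fun z => grad1 xi z.1) bs bxi.
move=> /(_ _ _)/wrap[].
- by bmeas.
- by move=> t; apply: (smax (fun x => t * grad1 xi x)); bmeas.
have := pairing bxi bD (bmeas_cst 0 : bmeas (fun _ : T' => 0 : R)).
under eq_exp do rewrite addr0; move=> ->.
under [X in _ + X]eq_exp do rewrite mul0r.
rewrite exp_cst addr0; under eq_exp do rewrite -expr2.
move=> /exp_eq0_ae h.
rewrite -[RHS]h; [|by bmeas|by move=> x; exact: sqr_ge0].
congr (P _); apply/seteqP; split => x /= /eqP; rewrite ?sqrf_eq0 => /eqP// ->.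
by rewrite expr0n.
Qed.

Lemma grad2_eq0 s xi : bmeas s -> bmeas xi ->
  (forall v, bmeas v ->
    dualR (fun z => s z + v z.2) (fun z => xi z + v z.2) <= dualR s xi) ->
  Q [set y | grad2 xi y = 0] = 1%E.
Proof.
move=> bs bxi smax.
have bD := bmeas_grad2 bxi.
have := @first_order_condition s xi (fun z => grad2 xi z.2) bs bxi.
move=> /(_ _ _)/wrap[].
- by bmeas.
- by move=> t; apply: (smax (fun x => t * grad2 xi x)); bmeas.
have := pairing bxi (bmeas_cst 0 : bmeas (fun _ : T => 0 : R)) bD.
under eq_exp do rewrite add0r; move=> ->.
under [X in X + _]eq_exp do rewrite mul0r.
rewrite exp_cst add0r; under eq_exp do rewrite -expr2.
move=> /exp_eq0_ae h.
rewrite -[RHS]h; [|by bmeas|by move=> x; exact: sqr_ge0].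
congr (Q _); apply/seteqP; split => x /= /eqP; rewrite ?sqrf_eq0 => /eqP// ->.
by rewrite expr0n.
Qed.

Lemma pairing_eq0 xi u v : bmeas xi -> bmeas u -> bmeas v ->
  P [set x | grad1 xi x = 0] = 1%E -> Q [set y | grad2 xi y = 0] = 1%E ->
  \int[PQ]_z ((u z.1 + v z.2) * (1 - eps^-1 * Num.max (xi z) 0)) = 0.
Proof.
move=> bxi bu bv P1 Q1; rewrite pairing//.
have bD1 := bmeas_grad1 bxi; have bD2 := bmeas_grad2 bxi.
rewrite (@ae_eq_exp _ _ _ P _ _ (cst 0)
  (measurable_zeros bD1) P1).
- rewrite (@ae_eq_exp _ _ _ Q _ _ (cst 0)
    (measurable_zeros bD2) Q1) ?exp_cst ?addr0//.
  + by bmeas.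
  + by bmeas.
  + by move=> y /= ->; rewrite mulr0.
- by bmeas.
- by bmeas.
- by move=> y /= ->; rewrite mulr0.
Qed.

(** Cauchy-Schwarz on L^2(P) * L^2(Q). *)
Lemma pairing_le F u v : bmeas F -> bmeas u -> bmeas v ->
  \int[P]_x u x = 0 ->
  (\int[PQ]_z ((u z.1 + v z.2) * (1 - eps^-1 * Num.max (F z) 0))) ^+ 2 <=
  (\int[PQ]_z (u z.1 + v z.2) ^+ 2) *
  (\int[P]_x (grad1 F x ^+ 2) + \int[Q]_y (grad2 F y ^+ 2)).
Proof.
move=> bF bu bv u0; rewrite pairing//.
have bD1 := bmeas_grad1 bF; have bD2 := bmeas_grad2 bF.
have -> : \int[PQ]_z (u z.1 + v z.2) ^+ 2 =
    \int[P]_x (u x ^+ 2) + \int[Q]_y (v y ^+ 2). by exact: oplus_sqr.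
have := cauchy_schwarz P bu bD1; have := cauchy_schwarz Q bv bD2.
have ge0 d0 (Z : measurableType d0) (mu : probability Z R) (D : Z -> R) :
  0 <= \int[mu]_x (D x ^+ 2) by apply: exp_ge0 => x; exact: sqr_ge0.
have := ge0 _ _ P u; have := ge0 _ _ Q v.
have := ge0 _ _ P (grad1 F); have := ge0 _ _ Q (grad2 F).
set a := \int[P]_x (u x ^+ 2); set b := \int[Q]_x (v x ^+ 2).
set a' := \int[P]_x (grad1 F x ^+ 2); set b' := \int[Q]_x (grad2 F x ^+ 2).
set p := \int[P]_x _; set q := \int[Q]_x _.
move=> b'0 a'0 b0 a0 hq hp.
have pq : 2 * (p * q) <= a * b' + b * a'.
  have : (p * q) ^+ 2 <= (a * b') * (b * a').
    rewrite exprMn (_ : a * b' * _ = (a * a') * (b * b')); last ring.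
    by apply: ler_pM => //; exact: sqr_ge0.
  have : 0 <= a * b' + b * a' by rewrite addr_ge0// mulr_ge0.
  set X := a * b'; set Y := b * a'; set Z := p * q => XY ZXY.
  have [//|lt] := leP (2 * Z) (X + Y).
  suff : (X + Y) ^+ 2 < (2 * Z) ^+ 2 by have := sqr_ge0 (X - Y); nra.
  by rewrite ltrXn2r// nnegrE; lra.
nra.
Qed.

End dual_gap.

(** * An inequality of Poincare type for additive functions *)

Section poincare.
Context {d d' : measure_display} {T : measurableType d} {T' : measurableType d'}.
Context {R : realType}.
Variables (P : probability T R) (Q : probability T' R).
Variables (u : T -> R) (v : T' -> R) (a : T * T' -> R).
Hypotheses (bu : bmeas u) (bv : bmeas v) (ba : bmeas a).
Hypothesis a_ge0 : forall z, 0 <= a z.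

Let PQ := pprod P Q.
Let h z := u z.1 + v z.2.
Let bh : bmeas h. Proof. by rewrite /h; bmeas. Qed.

(* A nonnegative function that is at least w on a set of mass at least q has
   mean at least q * w. *)
Let mass_le d0 (Z : measurableType d0) (mu : probability Z R) (B : set Z)
    (q w : R) (F : Z -> R) : measurable B -> (q%:E <= mu B)%E -> 0 <= w -> bmeas F ->
    (forall x, 0 <= F x) -> (forall x, B x -> w <= F x) ->
  q * w <= \int[mu]_x F x.
Proof.
move=> mB qB w0 bF F0 wF.
have bB := bmeas_indic mB (R := R).
apply: (@le_trans _ _ (fine (mu B) * w)).
  rewrite ler_wpM2r// -lee_fin fineK// fin_num_measure//.
rewrite -exp_indic// -expZr//; apply: le_exp; [by bmeas|by []|].
move=> x; rewrite indicE; have [xB|_] := boolP (x \in B); last by rewrite mul0r.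
by rewrite mul1r; apply: wF; exact: set_mem.
Qed.

(** For x and x' with S (x, x') = 1, the difference u x - u x' is also
    h (x, y) - h (x', y), for all the y of a set of mass at least q on which both
    weights are at least 1. *)
Lemma local_oscillation (S : T * T -> R) (G : set T) (q : R) :
    bmeas S -> 0 <= q -> (forall z, S z = 0 \/ S z = 1) ->
    measurable G -> P G = 1%E ->
    (forall x x', G x -> S (x, x') = 1 ->
      exists B, [/\ measurable B, (q%:E <= Q B)%E &
        forall y, B y -> 1 <= a (x, y) /\ 1 <= a (x', y)]) ->
  q * \int[pprod P P]_z (S z * (u z.1 - u z.2) ^+ 2) <=
  4 * \int[PQ]_z (a z * h z ^+ 2).
Proof.
move=> bS q0 S01 mG G1 GB.
pose H x := \int[Q]_y (a (x, y) * h (x, y) ^+ 2).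
have bH : bmeas H.
  by apply: (@bmeas_exp_snd _ _ _ _ _ P Q (fun z => a z * h z ^+ 2)); bmeas.
have H0 x : 0 <= H x by apply: exp_ge0 => y; rewrite mulr_ge0// sqr_ge0.
have -> : \int[PQ]_z (a z * h z ^+ 2) = \int[P]_x H x.
  by rewrite exp_pprod//; bmeas.
rewrite -expZ; last by bmeas.
apply: (@le_trans _ _ (\int[pprod P P]_z (2 * H z.1 + 2 * H z.2))); last first.
  rewrite expD; [|by bmeas..].
  rewrite (exp_pprod_fst P P (f := fun x => 2 * H x)); last by bmeas.
  rewrite (exp_pprod_snd P P (f := fun x => 2 * H x)); last by bmeas.
  by rewrite expZ//; lra.
apply: (@ae_le_exp _ _ _ _ (G `*` setT)).
- exact: measurableX.
- by apply: pprod_setX => //; exact: probability_setT.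
- by bmeas.
- by bmeas.
move=> [x x'] [/= Gx _].
have [->|S1] := S01 (x, x').
  by rewrite mul0r mulr0 addr_ge0// mulr_ge0.
have [B [mB qB Ba]] := GB x x' Gx S1.
rewrite S1 mul1r.
rewrite -!expZ; [|by bmeas..]; rewrite -expD; [|by bmeas..].
apply: (@mass_le _ _ _ B) => //.
- exact: sqr_ge0.
- by bmeas.
- by move=> y; apply: addr_ge0; rewrite mulr_ge0// mulr_ge0// sqr_ge0.
move=> y /Ba[a1 a2]; rewrite /h/=.
set b := u x + v y; set b' := u x' + v y.
have -> : u x - u x' = b - b' by rewrite /b /b'; ring.
have := sqr_ge0 (b + b'); have := sqr_ge0 b; have := sqr_ge0 b'.
nra.
Qed.

(** For almost every y, the value v y is h (x, y) - u x, for all the x of a set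
    of mass at least p on which the weight is at least 1. *)
Lemma second_marginal (G : set T') (p : R) :
    0 <= p -> measurable G -> Q G = 1%E ->
    (forall y, G y ->
      exists B, [/\ measurable B, (p%:E <= P B)%E &
        forall x, B x -> 1 <= a (x, y)]) ->
  p * \int[Q]_y (v y ^+ 2) <=
  2 * \int[PQ]_z (a z * h z ^+ 2) + 2 * \int[P]_x (u x ^+ 2).
Proof.
move=> p0 mG G1 GB.
rewrite exp_pprodC; last by bmeas.
rewrite -expZ; last by bmeas.
have bK : bmeas (fun y => \int[P]_x (a (x, y) * h (x, y) ^+ 2)).
  by apply: (@bmeas_exp_fst _ _ _ _ _ P Q (fun z => a z * h z ^+ 2)); bmeas.
rewrite -[X in _ + X](exp_cst Q) -[X in X + _]expZ// -expD; [|by bmeas..].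
apply: (ae_le_exp mG G1); [by bmeas..|].
move=> y /GB[B [mB pB Ba]].
rewrite -!expZ; [|by bmeas..]; rewrite -expD; [|by bmeas..].
apply: (@mass_le _ _ _ B) => //.
- exact: sqr_ge0.
- by bmeas.
- move=> x; have h2 := sqr_ge0 (h (x, y)); have u2 := sqr_ge0 (u x).
  by apply: addr_ge0; apply: mulr_ge0 => //; apply: mulr_ge0.
move=> x /Ba a1; rewrite /h/=.
have := sqr_ge0 (u x + v y); have := sqr_ge0 (2 * u x + v y).
nra.
Qed.

Lemma double_variance : \int[P]_x u x = 0 ->
  \int[pprod P P]_z ((u z.1 - u z.2) ^+ 2) = 2 * \int[P]_x (u x ^+ 2).
Proof.
move=> u0; under eq_exp do rewrite sqrrB mulr2n.
rewrite expD; [|by bmeas..]; rewrite expB; [|by bmeas..].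
rewrite expD; [|by bmeas..].
rewrite (exp_pprod_fst P P (f := fun x => u x ^+ 2)); last by bmeas.
rewrite (exp_pprod_snd P P (f := fun x => u x ^+ 2)); last by bmeas.
rewrite (_ : \int[_]_x (u x.1 * u x.2) = 0); first by ring.
rewrite exp_pprod; last by bmeas.
under eq_exp => x do [rewrite /= expZ; last by bmeas]; rewrite u0.
by under eq_exp do rewrite mulr0; rewrite exp_cst.
Qed.

(** If the oscillation of u over all pairs is controlled by the one over the
    pairs selected by S, then the norm of h = u (+) v is controlled by its norm
    weighted by a. *)
Lemma additive_poincare (S : T * T -> R) (G : set T) (G' : set T') (p q K : R) :
    \int[P]_x u x = 0 ->
    bmeas S -> (forall z, S z = 0 \/ S z = 1) ->
    0 <= p <= 1 -> 0 <= q <= 1 -> 1 <= K ->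
    measurable G -> P G = 1%E -> measurable G' -> Q G' = 1%E ->
    (forall x x', G x -> S (x, x') = 1 ->
      exists B, [/\ measurable B, (q%:E <= Q B)%E &
        forall y, B y -> 1 <= a (x, y) /\ 1 <= a (x', y)]) ->
    (forall y, G' y ->
      exists B, [/\ measurable B, (p%:E <= P B)%E &
        forall x, B x -> 1 <= a (x, y)]) ->
    \int[pprod P P]_z ((u z.1 - u z.2) ^+ 2) <=
      K * \int[pprod P P]_z (S z * (u z.1 - u z.2) ^+ 2) ->
  p * q * \int[PQ]_z (h z ^+ 2) <= 8 * K * \int[PQ]_z (a z * h z ^+ 2).
Proof.
move=> u0 bS S01 /andP[p0 p1] /andP[q0 q1] K1 mG G1 mG' G'1 GB G'B.
have := local_oscillation bS q0 S01 mG G1 GB.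
have := second_marginal p0 mG' G'1 G'B.
rewrite double_variance// (oplus_sqr Q bu bv u0).
have : 0 <= \int[PQ]_z (a z * h z ^+ 2).
  by apply: exp_ge0 => z; rewrite mulr_ge0// sqr_ge0.
have : 0 <= \int[P]_x (u x ^+ 2) by apply: exp_ge0 => z; rewrite sqr_ge0.
have : 0 <= \int[Q]_x (v x ^+ 2) by apply: exp_ge0 => z; rewrite sqr_ge0.
set E := \int[PQ]_z _; set U := \int[P]_x _; set V := \int[Q]_x _.
set W := \int[_]_z _.
move=> V0 U0 E0 pV qW UW.
have qU : q * U <= 2 * K * E by nra.
have pqU : p * (q * U) <= 2 * K * E by apply: le_trans qU; rewrite ler_piMl// mulr_ge0.
have pqV : q * (p * V) <= q * (2 * E + 2 * U) by rewrite ler_wpM2l.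
have qE : q * E <= K * E by rewrite ler_wpM2r//; lra.
nra.
Qed.

End poincare.

(** * The abstract error bound *)

Section error_bound.
Context {d d' : measure_display} {T : measurableType d} {T' : measurableType d'}.
Context {R : realType}.
Variables (P : probability T R) (Q : probability T' R) (eps : R).
Hypothesis eps_gt0 : 0 < eps.
Let PQ := pprod P Q.

(** Where t is at least eps / 2, the positive part has slope at least
    eps / (2 M) between t and any point at distance at most M. *)
Lemma maxr0_growth (M t b : R) : eps <= M -> eps / 2 <= t -> `|b| <= M ->
  eps / (2 * M) * b ^+ 2 <= (Num.max (t + b) 0 - Num.max t 0) * b.
Proof.
move=> eM et; rewrite ler_norml => /andP[Mb bM].
have M0 : 0 < M by apply: lt_le_trans eM.
have e0 := eps_gt0; have t0 : 0 < t by lra.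
rewrite (max_l (ltW t0)).
have -> : eps / (2 * M) * b ^+ 2 = (eps * b ^+ 2 / 2) / M by field; lra.
rewrite ler_pdivrMr//.
have [tb|tb] := leP 0 (t + b).
  have : 0 <= (M - eps) * b ^+ 2 by rewrite mulr_ge0 ?sqr_ge0// subr_ge0.
  have : 0 <= eps * b ^+ 2 by rewrite mulr_ge0 ?sqr_ge0// ltW.
  by rewrite addrAC subrr add0r => *; lra.
have b0 : b < 0 by lra.
have : 0 <= (t - eps / 2) * (- b) by rewrite mulr_ge0//; lra.
have : 0 <= eps * (- b) * (M + b) by rewrite !mulr_ge0//; lra.
have : 0 <= (t - eps / 2) * (- b) * M by rewrite !mulr_ge0//; lra.
nra.
Qed.

Lemma maxr0_monotone (t b : R) : 0 <= (Num.max (t + b) 0 - Num.max t 0) * b.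
Proof.
by rewrite /Num.max; case: ifPn => [ab|]; case: ifPn => [|]; rewrite -?leNgt => *; nra.
Qed.

Variables (xi a : T * T' -> R) (u : T -> R) (v : T' -> R).
Hypotheses (bxi : bmeas xi) (ba : bmeas a) (bu : bmeas u) (bv : bmeas v).
Hypothesis grad1_xi : P [set x | grad1 Q eps xi x = 0] = 1%E.
Hypothesis grad2_xi : Q [set y | grad2 P eps xi y = 0] = 1%E.
Let h z := u z.1 + v z.2.
Let F z := xi z + h z.

(** Strong monotonicity of the gradient along (u, v), on the region a = 1 where
    xi is at least eps / 2. *)
Lemma growth_pairing (M : R) : eps <= M ->
    (forall z, a z = 0 \/ [/\ a z = 1, eps / 2 <= xi z & `|h z| <= M]) ->
  \int[PQ]_z (a z * h z ^+ 2) <=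
  2 * M * - \int[PQ]_z (h z * (1 - eps^-1 * Num.max (F z) 0)).
Proof.
move=> eM aP.
have M0 : 0 < M by apply: lt_le_trans eM.
have bh : bmeas h by rewrite /h; bmeas.
have bF : bmeas F by rewrite /F; bmeas.
have Xi0 := pairing_eq0 bxi bu bv grad1_xi grad2_xi.
set Psi := \int[PQ]_z (h z * _); rewrite -[Psi]subr0 -Xi0 /Psi.
rewrite -expB; [|by bmeas..]; rewrite -expN; last by bmeas.
rewrite -expZ; last by bmeas.
apply: le_exp; [by bmeas..|] => z; rewrite -/(h z).
have -> : 2 * M * - (h z * (1 - eps^-1 * Num.max (F z) 0) -
    h z * (1 - eps^-1 * Num.max (xi z) 0)) =
    2 * M / eps * ((Num.max (F z) 0 - Num.max (xi z) 0) * h z).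
  by ring.
have [->|[-> xie hM]] := aP z.
  rewrite mul0r; apply: mulr_ge0; last exact: maxr0_monotone.
  by rewrite divr_ge0 ?mulr_ge0// ltW.
rewrite mul1r -ler_pdivrMl; last by rewrite divr_gt0 ?mulr_gt0.
by rewrite invf_div; exact: maxr0_growth.
Qed.

(** A lower bound of the weighted norm by the full norm turns strong
    monotonicity into the error bound, and concavity into the bound on the gap. *)
Lemma abstract_error_bound (M C : R) : eps <= M -> 0 <= C ->
    (forall z, a z = 0 \/ [/\ a z = 1, eps / 2 <= xi z & `|h z| <= M]) ->
    \int[PQ]_z (h z ^+ 2) <= C * \int[PQ]_z (a z * h z ^+ 2) ->
    let g2 := \int[P]_x (grad1 Q eps F x ^+ 2) +
              \int[Q]_y (grad2 P eps F y ^+ 2) in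
  \int[PQ]_z (h z ^+ 2) <= (2 * C * M) ^+ 2 * g2 /\
  - (\int[PQ]_z (h z * (1 - eps^-1 * Num.max (F z) 0))) <= 2 * C * M * g2.
Proof.
move=> eM C0 aP hC g2.
have M0 : 0 < M by apply: lt_le_trans eM.
have bh : bmeas h by rewrite /h; bmeas.
have bF : bmeas F by rewrite /F; bmeas.
have CM0 : 0 <= 2 * C * M by rewrite !mulr_ge0// ltW.
have := growth_pairing eM aP.
have g20 : 0 <= g2 by apply: addr_ge0; apply: exp_ge0 => ?; exact: sqr_ge0.
have hh0 : 0 <= \int[PQ]_z (h z ^+ 2) by apply: exp_ge0 => ?; exact: sqr_ge0.
have : (\int[PQ]_z (h z * (1 - eps^-1 * Num.max (F z) 0))) ^+ 2 <=
    \int[PQ]_z (h z ^+ 2) * g2.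
  (* Only h matters: u may be centred by moving a constant to v. *)
  pose m := \int[P]_x u x.
  have bu' : bmeas (fun x => u x - m) by bmeas.
  have bv' : bmeas (fun y => v y + m) by bmeas.
  have := @pairing_le _ _ _ _ _ P Q eps _ _ _ bF bu' bv'.
  rewrite expB ?exp_cst ?subrr//; last by bmeas.
  move=> /(_ erefl).
  have hE z : u z.1 - m + (v z.2 + m) = h z by rewrite /h; ring.
  have -> : \int[pprod P Q]_z ((u z.1 - m + (v z.2 + m)) ^+ 2) =
      \int[PQ]_z (h z ^+ 2) by apply: eq_exp => z; rewrite hE.
  by under eq_exp do rewrite hE.
move: hh0 hC.
set H := \int[PQ]_z (h z ^+ 2); set E := \int[PQ]_z (a z * _).
set Psi := \int[PQ]_z _ => H0 HCE PsiH EPsi.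
set k := 2 * C * M in CM0 *.
have Hk : H <= k * - Psi.
  apply: (le_trans HCE); rewrite /k.
  rewrite (_ : 2 * C * M * - Psi = C * (2 * M * - Psi)); last by ring.
  by rewrite ler_wpM2l.
have HH : H <= k ^+ 2 * g2.
  have [->|H_neq0] := eqVneq H 0; first by rewrite mulr_ge0// sqr_ge0.
  have Hgt0 : 0 < H by rewrite lt_neqAle eq_sym H_neq0.
  rewrite -(ler_pM2r Hgt0) -mulrA [g2 * H]mulrC.
  apply: (@le_trans _ _ (k ^+ 2 * Psi ^+ 2)); last by rewrite ler_wpM2l// sqr_ge0.
  rewrite -[X in _ <= _ * X]sqrrN -exprMn -expr2 lerXn2r// nnegrE//.
  exact: le_trans Hk.
split=> //.
have [Psi0|Psi0] := leP (- Psi) 0; first by rewrite (le_trans Psi0)// mulr_ge0.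
rewrite -(ler_pXn2r (n := 2))//; [|by rewrite nnegrE ltW|by rewrite nnegrE mulr_ge0].
rewrite sqrrN (le_trans PsiH)// exprMn expr2 mulrA.
by rewrite ler_wpM2r.
Qed.

End error_bound.

(** * Affine changes of variables for the Lebesgue measure *)

Section lebesgue_affine.
Context {R : realType}.
Local Open Scope ereal_scope.

Lemma lebesgue_affine (a b : R) (F : R -> \bar R) : (0 < a)%R ->
    measurable_fun setT F -> (forall x, 0 <= F x) ->
  a%:E * \int[lebesgue_measure]_t F (a * t + b)%R =
  \int[lebesgue_measure]_t F t.
Proof.
move=> a0 mF F0.
pose phi (t : measurableTypeR R) : measurableTypeR R := (a * t + b)%R.
have mphi : measurable_fun setT phi.
  by apply: measurable_funD => //; exact: measurable_funM.
pose k : {nonneg R} := NngNum (ltW a0).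
pose nuM : {measure set (measurableTypeR R) -> \bar R} := mscale k
  (measure_function_pushforward__canonical__measure_function_Measure
     lebesgue_measure mphi).
transitivity (\int[nuM]_t F t).
  rewrite ge0_integral_mscale//; congr (_ * _).
  by rewrite ge0_integral_pushforward.
apply: eq_measure_integral => A mA _; apply/esym.
apply: lebesgue_measure_unique => // X [[x y] _ <-].
rewrite /nuM/= /mscale/= /pushforward.
have -> : phi @^-1` `]x, y] = `]((x - b) / a)%R, ((y - b) / a)%R]%classic.
  apply/seteqP; split => t /=; rewrite !in_itv/= /phi ltr_pdivrMr// ler_pdivlMr//.
    by rewrite ltrBlDr lerBrDr mulrC.
  by rewrite ltrBlDr lerBrDr mulrC.
rewrite !lebesgue_measure_itv/= !lte_fin ltr_pM2r ?invr_gt0// ltrD2r.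
case: ifPn => _; last by rewrite mule0.
by rewrite -EFinD -EFinM; congr EFin; field; rewrite gt_eqF.
Qed.

Lemma measurable_rVcons n : measurable_fun setT (@rVcons R n).
Proof.
apply: measurable_fun_matrix => i j; rewrite [i]ord1.
case: (@split_ordP 1 n j) => k ->.
  rewrite [X in measurable_fun _ X](_ : _ = fst) //.
  apply/funext => -[x v].
  exact: etrans (@row_mxEl _ 1 1 n _ _ _ k) (mxE _ _ _ _).
rewrite [X in measurable_fun _ X](_ : _ = (fun v : 'rV[R]_n => v ord0 k) \o snd).
  by apply: measurableT_comp => //; exact: measurable_coord.
by apply/funext => -[x v]; exact: (@row_mxEr _ 1 1 n).
Qed.

Lemma measurable_affine_rV n (a : R) (b : 'rV[R]_n) :
  measurable_fun setT (fun v : 'rV[R]_n => a *: v + b)%R.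
Proof.
apply: measurable_fun_matrix => i j.
rewrite [X in measurable_fun _ X](_ : _ = fun v : 'rV[R]_n => (a * v i j + b i j)%R).
  apply: measurable_funD => //; apply: measurable_funM => //.
  exact: measurable_coord.
by apply/funext => v; rewrite !mxE.
Qed.

Lemma integral_rVS n (F : 'rV[R]_n.+1 -> \bar R) :
    measurable_fun setT F -> (forall x, 0 <= F x) ->
  \int[lebesgue_rV (n:=n.+1)]_v F v =
  \int[lebesgue_measure]_t \int[lebesgue_rV (n:=n)]_v F (rVcons (t, v)).
Proof.
move=> mF F0.
transitivity (\int[pushforward (lebesgue_measure \x lebesgue_rV (n:=n))
    (@rVcons R n)]_v F v).
  by apply: eq_measure_integral; [exact: measurable_rVcons|move=> ? A mA _].
rewrite ge0_integral_pushforward//; last exact: measurable_rVcons.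
rewrite preimage_setT fubini_tonelli1//.
  by apply: measurableT_comp => //; exact: measurable_rVcons.
by move=> x; exact: F0.
Qed.

Lemma lebesgue_rV_affine n (a : R) (b : 'rV[R]_n) (F : 'rV[R]_n -> \bar R) :
    (0 < a)%R -> measurable_fun setT F -> (forall x, 0 <= F x) ->
  (a ^+ n)%:E * \int[lebesgue_rV (n:=n)]_v F (a *: v + b)%R =
  \int[lebesgue_rV (n:=n)]_v F v.
Proof.
move=> a0; elim: n b F => [|n IH] b F mF F0.
  rewrite expr0 mul1e; apply: eq_integral => v _; congr F.
  by apply/matrixP => i [].
rewrite !integral_rVS//; last first.
  by apply: measurableT_comp => //; exact: measurable_affine_rV.
pose b0 := b 0%R ord0; pose b' : 'rV[R]_n := (\row_j b 0 (lift ord0 j))%R.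
have consE t v : (a *: rVcons (t, v) + b)%R = rVcons ((a * t + b0)%R, (a *: v + b')%R).
  apply/rowP => j; rewrite !mxE.
  case: (@split_ordP 1 n j) => k ->.
    rewrite !mxE; congr (_ + b _ _)%R; apply/val_inj => /=; by rewrite [k]ord1.
  by rewrite !mxE; congr (_ + b _ _)%R; exact/val_inj.
pose K t := \int[lebesgue_rV (n:=n)]_v F (rVcons (t, v)).
have mFc : measurable_fun setT (fun z => F (@rVcons R n z)).
  by apply: measurableT_comp => //; exact: measurable_rVcons.
have K0 t : 0 <= K t by apply: integral_ge0 => v _; exact: F0.
have mK : measurable_fun setT K.
  apply: (@measurable_fun_fubini_tonelli_F _ _ (measurableTypeR R) _ _
    (lebesgue_rV (n:=n)) (fun z => F (@rVcons R n z))) => //.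
rewrite -(lebesgue_affine b0 a0 mK K0) exprS EFinM -muleA; congr (_ * _).
have mF' t : measurable_fun setT (fun v => F (@rVcons R n (t, v))).
  exact: (measurableT_comp mFc (measurable_pair1 t)).
have aK t : (a ^+ n)%:E * \int[lebesgue_rV (n:=n)]_v
    F (a *: rVcons (t, v) + b)%R = K (a * t + b0)%R.
  rewrite /K -(IH b' (fun v => F (rVcons ((a * t + b0)%R, v))))//.
  by congr (_ * _); apply: eq_integral => v _; rewrite consE.
rewrite -ge0_integralZl//.
- by apply: eq_integral => t _; rewrite aK.
- apply: (@measurable_fun_fubini_tonelli_F _ _ (measurableTypeR R) _ _
    (lebesgue_rV (n:=n)) (fun z => F (a *: @rVcons R n z + b)%R)) => //.
  exact: (measurableT_comp mF
    (measurableT_comp (measurable_affine_rV a b) (@measurable_rVcons n))).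
- by move=> t _; apply: integral_ge0.
- by rewrite lee_fin exprn_ge0// ltW.
Qed.

Lemma measurable_comb_rV n (s t : R) :
  measurable_fun setT (fun z : 'rV[R]_n * 'rV[R]_n => s *: z.1 + t *: z.2)%R.
Proof.
apply: measurable_fun_matrix => i j.
rewrite [X in measurable_fun _ X](_ : _ =
    fun z : 'rV[R]_n * 'rV[R]_n => (s * z.1 i j + t * z.2 i j)%R).
  apply: measurable_funD; apply: measurable_funM => //.
    exact: (measurableT_comp (measurable_coord i j) measurable_fst).
  exact: (measurableT_comp (measurable_coord i j) measurable_snd).
by apply/funext => v; rewrite !mxE.
Qed.

(** Change of variables for the linear map sending (x, y) to two points of the
    line through x and y, at parameters t and t + s: its determinant on
    R^n * R^n is s ^+ n. It is a composition of translations, for one variable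
    fixed, and of one dilation. *)
Lemma lebesgue_segment n (s t : R) (G : 'rV[R]_n * 'rV[R]_n -> \bar R) :
    (0 < s)%R -> measurable_fun setT G -> (forall z, 0 <= G z) ->
  let lam := lebesgue_rV (n:=n) in
  (s ^+ n)%:E * \int[lam]_x \int[lam]_y
     G (x + t *: (y - x), x + (t + s) *: (y - x))%R =
  \int[lam]_z \int[lam]_w G (z, w).
Proof.
move=> s0 mG G0 lam.
pose comb (z : 'rV[R]_n * 'rV[R]_n) (r : R) : 'rV[R]_n := (1 *: z.1 + r *: z.2)%R.
have mcomb r : measurable_fun setT (comb ^~ r) by exact: measurable_comb_rV.
have mG2 r r' : measurable_fun setT (fun z => G (comb z r, comb z r')).
  by apply: (measurableT_comp mG); apply: measurable_fun_pair.
have -> : \int[lam]_x \int[lam]_y G (x + t *: (y - x), x + (t + s) *: (y - x))%R =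
    \int[lam]_x \int[lam]_D G (comb (x, D) t, comb (x, D) (t + s)%R).
  apply: eq_integral => x _.
  rewrite -(@lebesgue_rV_affine n 1 (- x)%R
    (fun D => G (comb (x, D) t, comb (x, D) (t + s)%R)))//; last first.
    exact: (measurableT_comp (mG2 t (t + s)%R) (measurable_pair1 x)).
  by rewrite expr1n mul1e; apply: eq_integral => y _; rewrite /comb/= !scale1r.
rewrite (@fubini_tonelli _ _ _ _ R lam lam
  (fun z => G (comb z t, comb z (t + s)%R)))//.
have -> : \int[lam]_D \int[lam]_x G (comb (x, D) t, comb (x, D) (t + s)%R) =
    \int[lam]_D \int[lam]_z G (comb (z, D) 0%R, comb (z, D) s).
  apply: eq_integral => D _.
  rewrite -(@lebesgue_rV_affine n 1 (t *: D)%R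
    (fun z => G (comb (z, D) 0%R, comb (z, D) s)))//; last first.
    exact: (measurableT_comp (mG2 0%R s) (measurable_pair2 D)).
  rewrite expr1n mul1e; apply: eq_integral => y _; rewrite /comb/= !scale1r.
  by rewrite scale0r addr0 scalerDl addrA.
rewrite -(@fubini_tonelli _ _ _ _ R lam lam
  (fun z => G (comb z 0%R, comb z s)))//.
rewrite -ge0_integralZl//.
- apply: eq_integral => z _.
  rewrite -(@lebesgue_rV_affine n s z (fun w => G (z, w)))//; last first.
    exact: (measurableT_comp mG (measurable_pair1 z)).
  congr (_ * _); apply: eq_integral => w _.
  by rewrite /comb/= !scale1r scale0r addr0 addrC.
- exact: (@measurable_fun_fubini_tonelli_F _ _ _ _ R lam
    (fun z => G (comb z 0%R, comb z s))).
- by move=> x _; exact: integral_ge0.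
- by rewrite lee_fin exprn_ge0// ltW.
Qed.

End lebesgue_affine.

(** * Chaining along segments *)

Section measure_comparison.
Context {d : measure_display} {T : measurableType d} {R : realType}.
Local Open Scope ereal_scope.
Variables (mu nu : {measure set T -> \bar R}) (D : set T) (k : R).
Hypotheses (mD : measurable D) (k0 : (0 <= k)%R).
Hypothesis munu : forall A, measurable A -> A `<=` D -> mu A <= k%:E * nu A.

Lemma ge0_integral_comparison (F : T -> \bar R) : measurable_fun setT F ->
    (forall x, 0 <= F x) -> (forall x, ~ D x -> F x = 0) ->
  \int[mu]_x F x <= k%:E * \int[nu]_x F x.
Proof.
move=> mF F0 FD.
have FE : F \_ D = F.
  apply/funext => x; rewrite patchE; case: ifPn => // /negP xD.
  by rewrite FD// => Dx; apply: xD; exact: mem_set.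
have onD (m : {measure set T -> \bar R}) :
    \int[m]_x F x = \int[mrestr m mD]_(x in D) F x.
  rewrite -{1}FE -integral_mkcond; apply/esym.
  by apply: eq_measure_integral => A mA AD; rewrite /= /mrestr setIidl.
rewrite !onD -(@ge0_integral_mscale _ _ _ (mrestr nu mD) _ mD (NngNum k0))//; last first.
  exact: measurable_funS mF.
apply: ge0_le_measure_integral => // S mS.
rewrite /= /mscale/= /mrestr; apply: munu; last exact: subIsetr.
exact: measurableI.
Qed.

End measure_comparison.

Section double_comparison.
Context {d : measure_display} {T : measurableType d} {R : realType}.
Local Open Scope ereal_scope.
Variables (mu nu : {sigma_finite_measure set T -> \bar R}) (D : set T) (k : R).
Hypotheses (mD : measurable D) (k0 : (0 <= k)%R).
Hypothesis munu : forall A, measurable A -> A `<=` D -> mu A <= k%:E * nu A.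

Lemma ge0_integral2_comparison (F : T * T -> \bar R) : measurable_fun setT F ->
    (forall z, 0 <= F z) -> (forall z, ~ (D z.1 /\ D z.2) -> F z = 0) ->
  \int[mu]_x \int[mu]_y F (x, y) <= (k ^+ 2)%:E * \int[nu]_x \int[nu]_y F (x, y).
Proof.
move=> mF F0 FD.
have mFx x : measurable_fun setT (fun y => F (x, y)).
  exact: (measurableT_comp mF (measurable_pair1 x)).
have inner x : \int[mu]_y F (x, y) <= k%:E * \int[nu]_y F (x, y).
  apply: (ge0_integral_comparison mD k0 munu) => // y Dy.
  by apply: FD => -[].
have mI (m : {sigma_finite_measure set T -> \bar R}) :
    measurable_fun setT (fun x => \int[m]_y F (x, y)).
  exact: (@measurable_fun_fubini_tonelli_F _ _ T T R m F).
have I0 (m : {measure set T -> \bar R}) x : 0 <= \int[m]_y F (x, y).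
  exact: integral_ge0.
apply: (@le_trans _ _ (\int[mu]_x (k%:E * \int[nu]_y F (x, y)))).
  have mImu := mI mu; have mInu := mI nu.
  by apply: ge0_le_integral => //; exact: measurable_funeM.
have mInu := mI nu; rewrite ge0_integralZl//.
rewrite expr2 EFinM -muleA lee_wpmul2l ?lee_fin//.
apply: (ge0_integral_comparison mD k0 munu) => //.
move=> x Dx; apply: integral0_eq => y _.
by apply: FD => -[].
Qed.

End double_comparison.

Section chaining.
Context {R : realType} {n : nat}.
Local Open Scope ereal_scope.
Notation V := 'rV[R]_n.
Variables (P : probability V R) (Om : set V) (rho : V -> R) (l L : R).
Hypotheses (mOm : measurable Om) (POm : P Om = 1).
Hypothesis rhoP : is_lebesgue_density P rho.
Hypotheses (l0 : (0 < l)%R) (lL : (l < L)%R).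
Hypothesis rho_bounds : forall x, Om x -> (l <= rho x <= L)%R.
Let lam : {sigma_finite_measure set V -> \bar R} := @lebesgue_rV R n.

Lemma density_upper A : measurable A -> A `<=` Om -> P A <= L%:E * lam A.
Proof.
move=> mA AO; have [mrho PE] := rhoP.
rewrite PE// -integral_cst//; apply: ge0_le_integral => //.
- by move=> x /AO/rho_bounds/andP[h _]; rewrite lee_fin (le_trans _ h)// ltW.
- by apply/measurable_EFinP; exact: measurable_funS mrho.
- by move=> x /AO/rho_bounds/andP[_ h]; rewrite lee_fin.
Qed.

Lemma density_lower A : measurable A -> A `<=` Om -> lam A <= (l^-1)%:E * P A.
Proof.
move=> mA AO; have [mrho PE] := rhoP.
rewrite -(@lee_pmul2l _ l%:E) ?lte_fin// muleA -EFinM mulfV ?gt_eqF// mul1e.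
rewrite PE// -integral_cst//; apply: ge0_le_integral => //.
- by move=> x _; rewrite lee_fin ltW.
- by apply/measurable_EFinP; exact: measurable_funS mrho.
- by move=> x /AO/rho_bounds/andP[h _]; rewrite lee_fin.
Qed.

Lemma sqr_sum_le (N : nat) (f : nat -> R) :
  ((\sum_(i < N) f i) ^+ 2 <= N%:R * \sum_(i < N) f i ^+ 2)%R.
Proof.
elim: N => [|N IH]; first by rewrite !big_ord0 expr0n mulr0.
rewrite !big_ord_recr/= -natr1.
set s := (\sum_(i < N) f i)%R in IH *; set q := (\sum_(i < N) f i ^+ 2)%R in IH *.
have [N0|N0] := posnP N.
  by rewrite /s /q N0 !big_ord0 !add0r mul1r.
have N0' : (0 < N%:R :> R)%R by rewrite ltr0n.
set b := f N; have : (0 <= (s - N%:R * b) ^+ 2)%R by exact: sqr_ge0.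
move: N%:R N0' IH => r r0 IH sb.
have : (r * (2 * s * b) <= r * (q + r * b ^+ 2))%R by nra.
by rewrite ler_pM2l// => h; nra.
Qed.

(** Points of the subdivision of the segment from z.1 to z.2 into N pieces. *)
Definition segment_pt (N : nat) (z : V * V) (i : nat) : V :=
  (z.1 + (i%:R / N%:R) *: (z.2 - z.1))%R.

(** The pairs of points of Om at distance at most r. *)
Definition near_pairs (r : R) : set (V * V) :=
  [set z | [/\ Om z.1, Om z.2 & enorm (z.1 - z.2) <= r]%R].

Lemma enormZ (a : R) (x : V) : (enorm (a *: x) = `|a| * enorm x)%R.
Proof.
rewrite /enorm; under eq_bigr do rewrite mxE exprMn.
rewrite -mulr_sumr sqrtrM ?sqr_ge0// sqrtr_sqr//.
Qed.

(** Telescoping along the subdivision of a segment, and Cauchy-Schwarz. *)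
Lemma chain_pointwise (N : nat) (D r : R) (u : V -> R) (z : V * V) :
    (0 < N)%N -> (D <= N%:R * r)%R ->
    convex_set (Om : set (convex_lmodType V)) ->
    (forall x y, Om x -> Om y -> enorm (x - y) <= D)%R ->
    Om z.1 -> Om z.2 ->
  ((u z.1 - u z.2) ^+ 2 <= N%:R * \sum_(i < N)
    \1_(near_pairs r) (segment_pt N z i, segment_pt N z i.+1) *
      (u (segment_pt N z i) - u (segment_pt N z i.+1)) ^+ 2)%R.
Proof.
move=> N0 DN cO diamO Ox Oy.
have N0' : (0 < N%:R :> R)%R by rewrite ltr0n.
have Opt i : (i <= N)%N -> Om (segment_pt N z i).
  move=> iN; have t1 : (i%:R / N%:R <= 1 :> R)%R by rewrite ler_pdivrMr// mul1r ler_nat.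
  have t0 : (0 <= i%:R / N%:R :> R)%R by rewrite divr_ge0.
  have := cO z.2 z.1 (Itv01 t0 t1) (mem_set Oy) (mem_set Ox); rewrite inE.
  congr Om; rewrite /conv/= /segment_pt; apply/rowP => j; rewrite !mxE/= /unstable.onem; ring.
have S01 i : (i < N)%N -> \1_(near_pairs r) (segment_pt N z i, segment_pt N z i.+1) = 1%R :> R.
  move=> iN; rewrite indicE mem_set// /near_pairs/=; split; [exact/Opt/ltnW|exact: Opt|].
  have -> : (segment_pt N z i - segment_pt N z i.+1 = N%:R^-1 *: (z.1 - z.2))%R.
    by apply/rowP => j; rewrite /segment_pt -natr1 !mxE; ring.
  rewrite enormZ gtr0_norm ?invr_gt0// mulrC ler_pdivrMr// mulrC.
  by rewrite (le_trans _ DN)// diamO.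
under eq_bigr => i _ do rewrite (S01 _ (ltn_ord i)) mul1r.
apply: le_trans (sqr_sum_le N (fun i => u (segment_pt N z i) - u (segment_pt N z i.+1))%R).
rewrite le_eqVlt; apply/orP; left; apply/eqP; congr (_ ^+ 2)%R.
have tele : (\sum_(i < N) (u (segment_pt N z i) - u (segment_pt N z i.+1)) =
    u (segment_pt N z 0) - u (segment_pt N z N))%R.
  rewrite -opprB -(telescope_sumr (fun i => u (segment_pt N z i)))// big_mkord -sumrN.
  by apply: eq_bigr => i _; rewrite opprB.
rewrite tele /segment_pt mul0r scale0r addr0 divff ?gt_eqF// scale1r.
by rewrite addrCA subrr addr0.
Qed.

Lemma measurable_enorm : measurable_fun setT (@enorm R n).
Proof.
apply: measurableT_comp.
  by apply: continuous_measurable_fun; exact: sqrt_continuous.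
apply: measurable_sum => i; apply: measurable_funX; exact: measurable_coord.
Qed.

Lemma measurable_near_pairs r : measurable (near_pairs r).
Proof.
have -> : near_pairs r = (Om `*` Om) `&`
    ((fun z => enorm (1 *: z.1 + (-1) *: z.2)%R) @^-1` `]-oo, r]).
  apply/seteqP; split => -[x y]/=; rewrite /near_pairs/= in_itv/= scale1r scaleN1r.
    by move=> [? ? ?].
  by move=> [[? ?] ?].
apply: measurableI; first exact: measurableX.
rewrite -[X in measurable X]setTI.
apply: (measurableT_comp measurable_enorm (@measurable_comb_rV R n 1 (-1))) => //.
Qed.

(** The mean oscillation of u over all pairs of points is controlled by the one
    over pairs at distance at most r. Passing from P to the Lebesgue measure and
    back costs L^2 / l^2; each of the N terms of the chain contributes the
    Jacobian N ^ n, and Cauchy-Schwarz another factor N. *)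
Lemma chaining (N : nat) (D r : R) (u : V -> R) :
    (0 < N)%N -> (D <= N%:R * r)%R ->
    convex_set (Om : set (convex_lmodType V)) ->
    (forall x y, Om x -> Om y -> enorm (x - y) <= D)%R ->
    bmeas u ->
  (\int[pprod P P]_z (u z.1 - u z.2) ^+ 2 <=
   (L ^+ 2 / l ^+ 2 * N%:R ^+ (n + 2)) *
   \int[pprod P P]_z (\1_(near_pairs r) z * (u z.1 - u z.2) ^+ 2))%R.
Proof.
move=> N0 DN cO diamO bu.
have N0' : (0 < N%:R :> R)%R by rewrite ltr0n.
have mB := measurable_near_pairs r.
have bB : bmeas (fun z => \1_(near_pairs r) z : R) by exact: bmeas_indic.
have mOO : measurable (Om `*` Om) by exact: measurableX.
have bOO : bmeas (fun z => \1_(Om `*` Om) z : R) by exact: bmeas_indic.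
have bd : bmeas (fun z : V * V => (u z.1 - u z.2) ^+ 2)%R by bmeas.
pose G z := (\1_(near_pairs r) z * (u z.1 - u z.2) ^+ 2)%:E.
pose W z := (\1_(Om `*` Om) z * (u z.1 - u z.2) ^+ 2)%:E.
have indic_ge0 (A : set (V * V)) z : (0 <= \1_A z :> R)%R.
  by rewrite indicE; case: (_ \in _).
have G0 z : 0 <= G z by rewrite lee_fin mulr_ge0// sqr_ge0.
have W0 z : 0 <= W z by rewrite lee_fin mulr_ge0// sqr_ge0.
have bG : bmeas (fun z => \1_(near_pairs r) z * (u z.1 - u z.2) ^+ 2)%R by bmeas.
have bW : bmeas (fun z => \1_(Om `*` Om) z * (u z.1 - u z.2) ^+ 2)%R by bmeas.
have mG : measurable_fun setT G.
  by apply/measurable_EFinP; case: bG.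
have mW : measurable_fun setT W.
  by apply/measurable_EFinP; case: bW.
have OO1 : pprod P P (Om `*` Om) = 1 by exact: pprod_setX.
have -> : (\int[pprod P P]_z ((u z.1 - u z.2) ^+ 2) =
    \int[pprod P P]_z (\1_(Om `*` Om) z * (u z.1 - u z.2) ^+ 2))%R.
  apply: (ae_eq_exp mOO OO1) => // z Oz.
  by rewrite indicE mem_set// mul1r.
rewrite -lee_fin EFinM -!bmeas_EFin//.
have -> : \int[pprod P P]_z W z = \int[P]_x \int[P]_y W (x, y).
  exact: fubini_tonelli1.
have -> : \int[pprod P P]_z G z = \int[P]_x \int[P]_y G (x, y).
  exact: fubini_tonelli1.
have L0 : (0 <= L)%R by rewrite ltW// (lt_trans l0).
have li0 : (0 <= l^-1)%R by rewrite invr_ge0 ltW.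
have WO z : ~ (Om z.1 /\ Om z.2) -> W z = 0.
  by move=> zO; rewrite /W indicE memNset ?mul0r.
have GO z : ~ (Om z.1 /\ Om z.2) -> G z = 0.
  move=> zO; rewrite /G indicE memNset ?mul0r//.
  by move=> [z1 z2 _]; apply: zO.
have upper : \int[P]_x \int[P]_y W (x, y) <=
    (L ^+ 2)%:E * \int[lam]_x \int[lam]_y W (x, y).
  exact: (ge0_integral2_comparison mOm L0 density_upper).
have lower : \int[lam]_x \int[lam]_y G (x, y) <=
    (l^-1 ^+ 2)%:E * \int[P]_x \int[P]_y G (x, y).
  exact: (ge0_integral2_comparison mOm li0 density_lower).
pose Gi i z := G (segment_pt N z i, segment_pt N z i.+1).
have Gi0 i z : 0 <= Gi i z by exact: G0.
have mpt i : measurable_fun setT (segment_pt N ^~ i).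
  rewrite [X in measurable_fun _ X](_ : _ = (fun z : V * V =>
    (1 - i%:R / N%:R) *: z.1 + (i%:R / N%:R) *: z.2)%R).
    exact: measurable_comb_rV.
  by apply/funext => z; apply/rowP => j; rewrite /segment_pt !mxE; ring.
have mGi i : measurable_fun setT (Gi i).
  by apply: (measurableT_comp mG); exact: measurable_fun_pair.
have IGi i : \int[lam]_x \int[lam]_y Gi i (x, y) =
    (N%:R ^+ n)%:E * \int[lam]_x \int[lam]_y G (x, y).
  have Ni0 : (0 < N%:R^-1 :> R)%R by rewrite invr_gt0.
  rewrite -(@lebesgue_segment R n N%:R^-1 (i%:R / N%:R) G)// muleA -EFinM.
  rewrite -exprMn mulfV ?gt_eqF// expr1n mul1e.
  apply: eq_integral => x _; apply: eq_integral => y _.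
  by rewrite /Gi /segment_pt/= -natr1 mulrDl mul1r.
have chain : \int[lam]_x \int[lam]_y W (x, y) <=
    (N%:R ^+ (n + 2))%:E * \int[lam]_x \int[lam]_y G (x, y).
  have tonelli F : measurable_fun setT F -> (forall z, 0 <= F z) ->
      \int[lam]_x \int[lam]_y F (x, y) = \int[lam \x lam]_z F z.
    by move=> mF F0; rewrite fubini_tonelli1.
  rewrite tonelli//.
  apply: (@le_trans _ _ (\int[lam \x lam]_z (N%:R%:E * \sum_(i < N) Gi i z))).
    apply: ge0_le_integral => //.
    - by apply: measurable_funeM; exact: emeasurable_sum.
    - move=> z _; have [Oz|/WO ->] := pselect (Om z.1 /\ Om z.2); last first.
        by rewrite mule_ge0 ?lee_fin// sume_ge0.
      rewrite sumEFin -EFinM lee_fin indicE mem_set ?mul1r; last by [].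
      by apply: (chain_pointwise (D := D)) => //; case: Oz.
  rewrite ge0_integralZl//; last 2 first.
  - exact: emeasurable_sum.
  - by move=> z _; exact: sume_ge0.
  rewrite ge0_integral_sum//.
  under eq_bigr => i _ do rewrite -tonelli// IGi.
  rewrite big_const card_ord -Monoid.iteropE -/(enatmul _ N) -mule_natl !muleA -!EFinM.
  by rewrite addn2 !exprS mulrA.
rewrite EFinM; apply: (le_trans upper).
rewrite [leRHS](_ : _ = (L ^+ 2)%:E * ((N%:R ^+ (n + 2))%:E *
  ((l^-1 ^+ 2)%:E * \int[P]_x \int[P]_y G (x, y)))).
  rewrite lee_wpmul2l ?lee_fin ?sqr_ge0//; apply: (le_trans chain).
  by rewrite lee_wpmul2l ?lee_fin ?exprn_ge0.
rewrite !muleA -!EFinM; congr (_%:E * _).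
by rewrite exprVn; ring.
Qed.

End chaining.

(** * L^2 norms and measures with a density *)

Section L2_norm.
Context {d : measure_display} {T : measurableType d} {R : realType}.
Variable mu : probability T R.
Local Open Scope ereal_scope.

Lemma ae_eq_full (A : set T) (F G : T -> \bar R) : measurable A -> mu A = 1 ->
  (forall x, A x -> F x = G x) -> ae_eq mu setT F G.
Proof.
move=> mA A1 FG; exists (~` A); split; first exact: measurableC.
  by rewrite [LHS]probability_setC// A1 subee.
by move=> x /= + Ax; apply => _; rewrite FG.
Qed.

Lemma Lnorm2_EFin (F : T -> \bar R) (f : T -> R) :
    measurable_fun setT F -> bmeas f -> ae_eq mu setT F (EFin \o f) ->
  'N[mu]_2%:E[F] = (Num.sqrt (\int[mu]_x (f x ^+ 2))%R)%:E.
Proof.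
move=> mF bf Ff; have [mf _] := bf.
have mpow (G : T -> \bar R) : measurable_fun setT G ->
    measurable_fun setT (fun x => `|G x| `^ 2).
  move=> mG; apply: (@measurableT_comp _ _ _ _ _ _ (fun x => x `^ 2)).
    exact: measurable_poweR.
  exact: measurableT_comp.
rewrite unlock.
rewrite (ae_eq_integral (fun x => `|(f x)%:E| `^ 2))//.
- under eq_integral => x _ do rewrite /= powR_mulrn// -normrX ger0_norm ?sqr_ge0//.
  rewrite bmeas_EFin; last by bmeas.
  rewrite poweR12_sqrt// lee_fin.
  by apply: exp_ge0 => x; exact: sqr_ge0.
- exact: mpow.
- by apply: mpow; exact/measurable_EFinP.
- by apply: filterS Ff => x /= /[apply] ->.
Qed.

End L2_norm.

Section density.
Context {d : measure_display} {T : measurableType d} {R : realType}.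
Variables (mu : probability T R) (w : T -> R).
Hypotheses (bw : bmeas w) (w0 : forall x, 0 <= w x) (w1 : \int[mu]_x w x = 1).
Local Open Scope ereal_scope.

Lemma probability_density : exists pi : probability T R,
  forall A, measurable A -> pi A = \int[mu]_(x in A) (w x)%:E.
Proof.
have mw : measurable_fun setT (EFin \o w) by apply/measurable_EFinP; case: bw.
have we0 x : 0 <= (EFin \o w) x by rewrite lee_fin.
pose nu (A : set T) := \int[mu]_(x in A) (EFin \o w) x.
have nu0 : nu set0 = 0 by rewrite /nu integral_set0.
have nu_ge0 A : 0 <= nu A by exact: integral_ge0.
have nu_add : semi_sigma_additive nu by exact: semi_sigma_additive_nng_induced.
pose nuM : {measure set T -> \bar R} :=
  HB.pack nu (isMeasure.Build _ _ _ nu nu0 nu_ge0 nu_add).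
have nu1 : nuM setT = 1 by rewrite /nuM/= /nu bmeas_EFin// w1.
pose nuP : probability T R :=
  HB.pack nu nuM (Measure_isProbability.Build _ _ _ nuM nu1).
by exists nuP.
Qed.

Local Open Scope charge_scope.

Lemma density_dominates (pi : probability T R) :
  (forall A, measurable A -> pi A = \int[mu]_(x in A) (w x)%:E) -> pi `<< mu.
Proof.
move=> piE; apply/null_content_dominatesP => A mA muA; rewrite piE//.
apply: null_set_integral => //; apply: measurable_funTS.
by apply/measurable_EFinP; case: bw.
Qed.

Lemma density_Radon_Nikodym (pi : probability T R) :
  (forall A, measurable A -> pi A = \int[mu]_(x in A) (w x)%:E) ->
  ae_eq mu setT ('d (charge_of_finite_measure pi) '/d mu) (EFin \o w).
Proof.
move=> piE; have dom := density_dominates piE.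
apply: integral_ae_eq => //.
- exact: Radon_Nikodym_integrable.
- by apply/measurable_EFinP; case: bw.
move=> E _ mE; rewrite -Radon_Nikodym_integral//.
exact: piE.
Qed.

Lemma density_integral (pi : probability T R) (c : T -> R) :
  (forall A, measurable A -> pi A = \int[mu]_(x in A) (w x)%:E) ->
  bmeas c ->
  \int[pi]_x (c x)%:E = (\int[mu]_x (c x * w x))%R%:E.
Proof.
move=> piE bc; have dom := density_dominates piE.
have ic : pi.-integrable setT (EFin \o c) by exact: bmeas_integrable.
rewrite -[LHS](Radon_Nikodym_change_of_variables dom measurableT ic).
rewrite -bmeas_EFin; last by bmeas.
have mc : measurable_fun setT (EFin \o c) by exact: measurable_int ic.
apply: ae_eq_integral => //.
- exact: emeasurable_funM.
- by apply/measurable_EFinP; apply: measurable_funM; [case: bc|case: bw].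
- have := density_Radon_Nikodym piE.
  by apply: filterS => x /= /[apply] ->; rewrite EFinM.
Qed.

End density.

(** * The optimal coupling *)

Section primal_bound.
Context {R : realType} {n : nat}.
Local Open Scope ereal_scope.
Notation V := 'rV[R]_n.
Variables (P Q : probability V R) (eps : R) (c : V -> V -> R).
Hypothesis eps_gt0 : (0 < eps)%R.
Variables (a b : V -> R) (c1 : V * V -> R) (D : set (V * V)).
Hypotheses (ba : bmeas a) (bb : bmeas b) (bc1 : bmeas c1).
Hypothesis mc : measurable_fun setT (fun z : V * V => c z.1 z.2).
Hypotheses (mD : measurable D) (D1 : pprod P Q D = 1).
Hypothesis cD : forall z, D z -> c z.1 z.2 = c1 z.
Let s (z : V * V) : R := (a z.1 + b z.2)%R.
Let xi (z : V * V) : R := (s z - c1 z)%R.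
Hypothesis grad1_xi : P [set x | grad1 Q eps xi x = 0%R] = 1.
Hypothesis grad2_xi : Q [set y | grad2 P eps xi y = 0%R] = 1.

(** The plan of density (a (+) b - c)_+ / eps is a coupling, by the first order
    conditions, and its primal cost equals the dual value. *)
Lemma QOT_le_dualR : QOT P Q c eps <= (dualR P Q eps s xi)%:E.
Proof.
have bs : bmeas s by rewrite /s; bmeas.
have bxi : bmeas xi by rewrite /xi; bmeas.
pose w z : R := (eps^-1 * Num.max (xi z) 0)%R.
have bw : bmeas w by rewrite /w; bmeas.
have ei : (0 < eps^-1)%R by rewrite invr_gt0.
have w0 z : (0 <= w z)%R by rewrite mulr_ge0 ?le_max ?lexx ?orbT// ltW.
have wu (u : V -> R) : bmeas u ->
    (\int[pprod P Q]_z (u z.1 * w z) = \int[P]_x u x)%R.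
  move=> bu; have := pairing_eq0 bxi bu (bmeas_cst (0 : R)) grad1_xi grad2_xi.
  under eq_exp do rewrite addr0 mulrBr mulr1; rewrite expB; [|by bmeas..].
  by rewrite exp_pprod_fst// => /eqP; rewrite subr_eq0 => /eqP <-.
have wv (v : V -> R) : bmeas v ->
    (\int[pprod P Q]_z (v z.2 * w z) = \int[Q]_y v y)%R.
  move=> bv; have := pairing_eq0 bxi (bmeas_cst (0 : R)) bv grad1_xi grad2_xi.
  under eq_exp do rewrite add0r mulrBr mulr1; rewrite expB; [|by bmeas..].
  by rewrite exp_pprod_snd// => /eqP; rewrite subr_eq0 => /eqP <-.
have w1 : (\int[pprod P Q]_z w z = 1)%R.
  have := wu _ (bmeas_cst (1 : R)); rewrite exp_cst => <-.
  by apply: eq_exp => z; rewrite mul1r.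
have [pi piE] := probability_density bw w0 w1.
have piI (A : set (V * V)) : measurable A ->
    pi A = (\int[pprod P Q]_z (\1_A z * w z))%R%:E.
  move=> mA; have bA := bmeas_indic mA (R := R).
  rewrite piE// -bmeas_EFin; last by bmeas.
  rewrite integral_mkcond; apply: eq_integral => z _.
  by rewrite patchE indicE; case: ifPn; rewrite ?mul1r ?mul0r.
have cpl : is_coupling P Q pi.
  split => A mA.
    rewrite piI; last exact: measurableX.
    rewrite (eq_exp _ (g := fun z => \1_A z.1 * w z)%R); last first.
      by move=> z; rewrite !indicE in_setX in_setT andbT.
    by rewrite wu; [rewrite exp_indic// fineK// fin_num_measure|exact: bmeas_indic].
  rewrite piI; last exact: measurableX.
  rewrite (eq_exp _ (g := fun z => \1_A z.2 * w z)%R); last first.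
    by move=> z; rewrite !indicE in_setX in_setT.
  by rewrite wv; [rewrite exp_indic// fineK// fin_num_measure|exact: bmeas_indic].
have dom := density_dominates bw piE.
apply: (@le_trans _ _ (qot_objective P Q c eps pi)).
  by apply: ereal_inf_lbound; exists pi.
rewrite /qot_objective asboolT//.
have piD : pi D = 1.
  rewrite piI// -w1; congr EFin.
  have bD := bmeas_indic mD (R := R).
  apply: (ae_eq_exp mD D1) => //; first by bmeas.
  by move=> z Dz; rewrite indicE mem_set// mul1r.
have -> : \int[pi]_z (c z.1 z.2)%:E = \int[pi]_z (c1 z)%:E.
  apply: ae_eq_integral => //; first exact/measurable_EFinP.
    by apply/measurable_EFinP; case: bc1.
  by apply: (ae_eq_full mD piD) => z /cD ->.
rewrite (density_integral bw piE bc1).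
rewrite (Lnorm2_EFin _ bw (density_Radon_Nikodym bw piE)); last first.
  by apply: (measurable_int (prod_prob P Q)); exact: Radon_Nikodym_integrable.
have W0 : (0 <= \int[prod_prob P Q]_z (w z ^+ 2))%R.
  by apply: exp_ge0 => z; exact: sqr_ge0.
rewrite -EFin_expe sqr_sqrtr// -EFinM -EFinD lee_fin.
rewrite le_eqVlt; apply/orP; left; apply/eqP.
rewrite -expZ; last by bmeas.
rewrite -expD; [|by bmeas..].
have -> : dualR P Q eps s xi =
    (\int[pprod P Q]_z (s z * w z - (2 * eps)^-1 * Num.max (xi z) 0 ^+ 2))%R.
  rewrite /dualR !expB; [|by bmeas..]; congr (_ - _)%R.
  rewrite -[LHS]subr0 -(pairing_eq0 bxi ba bb grad1_xi grad2_xi) -expB; [|by bmeas..].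
  by apply: eq_exp => z; rewrite -/(s z) -/(w z); ring.
apply: eq_exp => z; rewrite /w.
have xiE : (xi z * Num.max (xi z) 0 = Num.max (xi z) 0 ^+ 2)%R.
  by rewrite /Num.max; case: ifPn => _; rewrite ?mulr0 ?expr0n// expr2.
have -> : (c1 z = s z - xi z)%R by rewrite /xi; ring.
have -> : ((s z - xi z) * (eps^-1 * Num.max (xi z) 0) =
  s z * (eps^-1 * Num.max (xi z) 0) - eps^-1 * (xi z * Num.max (xi z) 0))%R by ring.
by rewrite xiE; field; rewrite gt_eqF.
Qed.

End primal_bound.

(** * The Euclidean norm, supports and balls *)

Lemma sqrt_sum_sqr_le (R : realType) (p q : R) : 0 <= p -> 0 <= q ->
  Num.sqrt (p ^+ 2 + q ^+ 2) <= p + q.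
Proof.
move=> p0 q0.
rewrite -[leRHS]ger0_norm ?addr_ge0// -sqrtr_sqr ler_wsqrtr//; nra.
Qed.

Section euclidean_norm.
Context {R : realType} {n : nat}.
Notation V := 'rV[R]_n.
Implicit Types (x y : V) (S : set V).

Lemma enorm_ge0 x : 0 <= enorm x.
Proof. exact: sqrtr_ge0. Qed.

Lemma enormN x : enorm (- x) = enorm x.
Proof. by rewrite -scaleN1r enormZ normrN1 mul1r. Qed.

Lemma enormBC x y : enorm (x - y) = enorm (y - x).
Proof. by rewrite -opprB enormN. Qed.

Lemma enorm_le x (e : R) : 0 <= e -> (forall i, `|x 0 i| <= e) ->
  enorm x <= Num.sqrt n%:R * e.
Proof.
move=> e0 xe; rewrite -[leRHS]ger0_norm ?mulr_ge0// -[leRHS]sqrtr_sqr.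
rewrite ler_wsqrtr// exprMn sqr_sqrtr//.
apply: (@le_trans _ _ (\sum_(i < n) e ^+ 2)).
  by apply: ler_sum => i _; rewrite -[leLHS]real_normK ?num_real// lerXn2r ?nnegrE.
by rewrite sumr_const card_ord mulr_natl.
Qed.

Lemma ball_enorm_le x y (e : R) : ball x e y -> enorm (x - y) <= Num.sqrt n%:R * e.
Proof.
move=> [e0 xy]; apply: enorm_le; first exact: ltW.
by move=> i; rewrite !mxE ltW//; exact: (xy 0 i).
Qed.

(** A radius such that two points of a common ball of the max norm of this
    radius are at Euclidean distance less than r. *)
Definition max_radius (r : R) : R := r / (2 * (Num.sqrt n%:R + 1)).

Lemma max_radius_gt0 r : 0 < r -> 0 < max_radius r.
Proof. by move=> r0; rewrite divr_gt0// mulr_gt0// ltr_wpDl. Qed.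

Lemma max_radius_lt r : 0 < r -> Num.sqrt n%:R * (max_radius r + max_radius r) < r.
Proof.
move=> r0; rewrite /max_radius.
have : 0 <= Num.sqrt n%:R :> R by rewrite sqrtr_ge0.
move: (Num.sqrt n%:R) => k k0.
have -> : k * (r / (2 * (k + 1)) + r / (2 * (k + 1))) = r * k / (k + 1).
  by field; lra.
by rewrite ltr_pdivrMr; [nra|lra].
Qed.

Lemma measurable_eball x r : measurable (eball x r).
Proof.
have -> : eball x r = (fun y => enorm (1 *: y + - x)) @^-1` `]-oo, r[.
  by apply/seteqP; split => y; rewrite /eball/= in_itv/= scale1r.
rewrite -[X in measurable X]setTI.
by apply: (measurableT_comp (@measurable_enorm R n) (measurable_affine_rV 1 (- x))).
Qed.

Lemma enorm_ediam S x y : compact S -> S x -> S y -> enorm (x - y) <= ediam S.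
Proof.
move=> cS Sx Sy; apply: ub_le_sup; last by exists x => //; exists y.
have /compact_bounded [M [_ Mb]] := cS.
have := Mb (`|M| + 1); rewrite (le_lt_trans (ler_norm _)) ?ltrDl// => /(_ isT) SM.
have M0 : 0 <= `|M| + 1 by rewrite addr_ge0.
have coord (z : V) i : S z -> `|z 0 i| <= `|M| + 1.
  move=> Sz; apply: le_trans (SM _ Sz).
  rewrite [leRHS]mx_normrE.
  exact: (le_bigmax _ (fun i => `|z i.1 i.2|) (0, i)).
exists (Num.sqrt n%:R * (2 * (`|M| + 1))) => _ [a Sa [b Sb <-]].
apply: enorm_le; first by rewrite mulr_ge0.
move=> i; rewrite !mxE (le_trans (ler_normB _ _))// mulr_natl mulr2n.
by rewrite lerD// coord.
Qed.

Lemma ediam_ge0 S x : compact S -> S x -> 0 <= ediam S.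
Proof. by move=> cS Sx; rewrite (le_trans _ (enorm_ediam cS Sx Sx))// enorm_ge0. Qed.

Lemma elipschitz_bounded S (L : R) (f : V -> R) : 0 < L -> compact S ->
  elipschitz_on S L f -> exists M, forall x, S x -> `|f x| <= M.
Proof.
move=> L0 cS fL; have [->|/set0P[x0 Sx0]] := eqVneq S set0; first by exists 0.
exists (`|f x0| + L * ediam S) => x Sx.
rewrite -[f x](subrK (f x0)) addrC (le_trans (ler_normD _ _))// lerD2l.
rewrite (le_trans (fL _ _ Sx Sx0))//; apply: ler_wpM2l; first exact: ltW.
exact: enorm_ediam.
Qed.

(** Joint measurability for the product sigma-algebra: c is a continuous function
    on R^(2n). *)
Lemma measurable_elipschitz2 (L : R) (c : V -> V -> R) : 0 < L ->
  elipschitz2 L c -> measurable_fun setT (fun z : V * V => c z.1 z.2).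
Proof.
move=> L0 cL.
pose C (w : 'rV[R]_(n + n)) := c (lsubmx w) (rsubmx w).
have -> : (fun z : V * V => c z.1 z.2) = C \o (fun z => row_mx z.1 z.2).
  by apply/funext => z; rewrite /C/= row_mxKl row_mxKr.
apply: (@measurableT_comp _ _ _ _ _ _ C); last first.
  apply: measurable_fun_matrix => i j; case: (split_ordP j) => k ->.
    rewrite [X in measurable_fun _ X](_ : _ = (fun v : V => v i k) \o fst).
      by apply: measurableT_comp => //; exact: measurable_coord.
    by apply/funext => z; rewrite row_mxEl.
  rewrite [X in measurable_fun _ X](_ : _ = (fun v : V => v i k) \o snd).
    by apply: measurableT_comp => //; exact: measurable_coord.
  by apply/funext => z; rewrite row_mxEr.
have cC : continuous C.
  move=> w s /= /(nbhs_ballP (C w)) [e /= e0 es].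
  pose K := 2 * L * Num.sqrt n%:R + 1.
  have k0 : 0 <= Num.sqrt n%:R :> R by exact: sqrtr_ge0.
  have L0' := ltW L0.
  have K0 : 0 < K by rewrite /K ltr_wpDl// !mulr_ge0.
  have eK : 0 < e / K by rewrite divr_gt0.
  apply/nbhs_ballP; exists (e / K) => //= w' [_ ww']; apply: es.
  rewrite /ball/=.
  rewrite /C (le_lt_trans (cL _ _ _ _))//.
  have sub (x : V) : (forall i, `|x 0 i| <= e / K) -> enorm x <= Num.sqrt n%:R * (e / K).
    by apply: enorm_le; exact: ltW.
  have h1 : enorm (lsubmx w - lsubmx w') <= Num.sqrt n%:R * (e / K).
    by apply: sub => i; rewrite !mxE ltW//; exact: (ww' 0).
  have h2 : enorm (rsubmx w - rsubmx w') <= Num.sqrt n%:R * (e / K).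
    by apply: sub => i; rewrite !mxE ltW//; exact: (ww' 0).
  have := enorm_ge0 (lsubmx w - lsubmx w'); have := enorm_ge0 (rsubmx w - rsubmx w').
  move: (enorm _) (enorm _) h1 h2 => p q h1 h2 q0 p0.
  have spq := sqrt_sum_sqr_le q0 p0.
  apply: (@le_lt_trans _ _ (L * (2 * (Num.sqrt n%:R * (e / K))))).
    apply: ler_wpM2l => //; rewrite addrC (le_trans spq)// mulr_natl mulr2n.
    by rewrite lerD.
  have -> : L * (2 * (Num.sqrt n%:R * (e / K))) = e * (2 * L * Num.sqrt n%:R / K).
    by ring.
  by rewrite gtr_pMr// ltr_pdivrMr// mul1r /K ltrDl.
apply: (measurability _ (RGenOpens.measurableE R)) => _ [_ [a [b ->] <-]].
rewrite setTI; apply: open_measurable_matrix.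
by apply: open_comp; [move=> x _; exact: cC|exact: interval_open].
Qed.

End euclidean_norm.

Section support.
Context {R : realType} {n : nat}.
Notation V := 'rV[R]_n.
Variables (mu : probability V R) (S : set V).
Hypotheses (suppS : is_support mu S) (cS : compact S).

Lemma closed_measurable_matrix (A : set V) : closed A -> measurable A.
Proof.
move=> cA; rewrite -(setCK A); apply: measurableC.
by apply: open_measurable_matrix; exact: closed_openC.
Qed.

Lemma support_measurable : measurable S.
Proof. by apply: closed_measurable_matrix; case: suppS. Qed.

Lemma support_nonempty : exists x, S x.
Proof.
apply/set0P/eqP => S0; have [_ + _] := suppS; rewrite S0 measure0 => /eqP.
by rewrite eq_sym onee_eq0.
Qed.

Lemma support_mass_gt0 y (U : set V) : S y -> open U -> U y -> (0 < mu U)%E.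
Proof.
move=> Sy oU Uy; have mU := open_measurable_matrix oU.
rewrite lt_neqAle measure_ge0 andbT; apply/eqP => U0.
have [_ _ minS] := suppS.
have : S `<=` ~` U.
  apply: minS; first exact: open_closedC.
  by rewrite probability_setC// -U0 sube0.
by move=> /(_ _ Sy).
Qed.

Variable r : R.
Hypothesis r0 : 0 < r.
Let q := inf [set fine (mu (eball y r)) | y in S].

Lemma inf_mass_le y : S y -> (q%:E <= mu (eball y r))%E.
Proof.
move=> Sy; rewrite -[leRHS]fineK; last first.
  by rewrite fin_num_measure//; exact: measurable_eball.
rewrite lee_fin; apply: ge_inf; last by exists y.
by exists 0 => _ [z _ <-]; exact: fine_ge0.
Qed.

Lemma inf_mass_le1 : q <= 1.
Proof.
have [y Sy] := support_nonempty; rewrite -lee_fin (le_trans (inf_mass_le Sy))//.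
by apply: probability_le1; exact: measurable_eball.
Qed.

(** Cover the compact support by finitely many balls so small that every ball of
    radius r centred in the support contains one of them. *)
Lemma inf_mass_gt0 : 0 < q.
Proof.
have e0 := @max_radius_gt0 R n _ r0.
move: (max_radius_lt (n := n) r0); set e := max_radius r in e0 * => er.
have := cS; rewrite compact_cover => /(_ V S (fun y => ball y e)).
have bo y : S y -> open (ball y e) by move=> _; exact: ball_open.
move=> /(_ bo)[].
  by move=> y Sy; exists y => //; exact: ballxx.
move=> F FS Fcov.
have [m m0 mF] : exists2 m : R, 0 < m &
    forall y, y \in (F : seq V) -> (m%:E <= mu (ball y e))%E.
  have : forall y, y \in (F : seq V) -> S y by move=> y /FS /set_mem.
  elim: (F : seq V) => [_|y s IH sS]; first by exists 1.
  have [|m m0 ms] := IH; first by move=> z zs; apply: sS; rewrite inE zs orbT.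
  have Sy : S y by apply: sS; rewrite mem_head.
  have y0 := support_mass_gt0 Sy (bo _ Sy) (ballxx y e0).
  have mb : measurable (ball y e) by apply: open_measurable_matrix; exact: bo.
  have fb : mu (ball y e) \is a fin_num by exact: fin_num_measure.
  exists (Num.min m (fine (mu (ball y e)))).
    by rewrite lt_min m0 -lte_fin fineK.
  move=> z; rewrite inE => /orP[/eqP ->|zs].
    by rewrite -[leRHS]fineK// lee_fin ge_min lexx orbT.
  by rewrite (le_trans _ (ms _ zs))// lee_fin ge_min lexx.
apply: (lt_le_trans m0); apply: lb_le_inf.
  by have [y Sy] := support_nonempty; exists (fine (mu (eball y r))), y.
move=> _ [y Sy <-]; rewrite -lee_fin fineK; last first.
  by rewrite fin_num_measure//; exact: measurable_eball.
have [z zF zy] := Fcov _ Sy.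
rewrite (le_trans (mF z zF))//; apply: le_measure.
- by apply: mem_set; apply: open_measurable_matrix; exact: ball_open.
- by apply: mem_set; exact: measurable_eball.
move=> w zw; rewrite /eball/=.
have yw : ball y (e + e) w by apply: ball_triangle zw; exact: ball_sym.
by rewrite enormBC (le_lt_trans (ball_enorm_le yw)).
Qed.

(** A measure with a density does not charge points, so that its support is not
    reduced to one. *)
Lemma ediam_gt0 rho : (0 < n)%N -> is_lebesgue_density mu rho -> 0 < ediam S.
Proof.
move=> n0 [mrho muE]; have [x Sx] := support_nonempty.
rewrite lt_neqAle (ediam_ge0 cS Sx) andbT; apply/eqP => S0.
have Sx1 : S `<=` [set x].
  move=> y Sy; have := enorm_ediam cS Sy Sx; rewrite -S0 => yx.
  have : enorm (y - x) = 0 by apply/eqP; rewrite eq_le yx enorm_ge0.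
  move=> /eqP; rewrite sqrtr_eq0 => sle.
  have s0 : \sum_(i < n) (y - x) 0 i ^+ 2 = 0.
    by apply/eqP; rewrite eq_le sle sumr_ge0// => i _; exact: sqr_ge0.
  apply/rowP => i; apply/eqP; rewrite -subr_eq0 -sqrf_eq0.
  have := psumr_eq0P (fun i _ => sqr_ge0 _) s0.
  by move=> /(_ i isT); rewrite !mxE => ->.
pose X : set V := [set y : V | forall i, [set x 0 i] (y 0 i)].
have XE : X = [set x].
  apply/seteqP; split => y; last by move=> -> i.
  by move=> Xy; apply/rowP => i; exact: Xy.
have mX : measurable [set x].
  rewrite (_ : [set x] = S); first exact: support_measurable.
  by apply/seteqP; split => // y ->.
have X0 : @lebesgue_rV R n [set x] = 0%E.
  rewrite -XE (lebesgue_rV_box (A := fun i => [set x 0 i])); last by [].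
  rewrite (bigD1 (Ordinal n0))//= lebesgue_measure_set1 mul0e//.
have : (1 <= mu [set x])%E.
  have [_ <- _] := suppS; apply: le_measure => //; apply: mem_set => //.
  exact: support_measurable.
rewrite muE// null_set_integral//.
  by rewrite leNgt lte01.
by apply/measurable_EFinP; exact: measurable_funS mrho.
Qed.

End support.

(** * From potentials on the supports to bounded functions *)

Section restriction.
Context {d : measure_display} {T : measurableType d} {R : realType}.
Variable mu : probability T R.
Implicit Types (A : set T) (f : T -> R).

(** The function equal to f on A and to 0 elsewhere. *)
Definition restr0 A f x : R := f x * \1_A x.

Lemma restr0E A f x : A x -> restr0 A f x = f x.
Proof. by move=> Ax; rewrite /restr0 indicE mem_set// mulr1. Qed.

Lemma bmeas_restr0 A f : measurable A -> measurable_fun setT f ->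
  (exists M, forall x, A x -> `|f x| <= M) -> bmeas (restr0 A f).
Proof.
move=> mA mf [M fM]; split.
  by apply: measurable_funM => //; exact: measurable_indic.
exists (Num.max M 0) => x; rewrite /restr0 indicE.
have [xA|_] := boolP (x \in A); last by rewrite mulr0 normr0 le_max lexx orbT.
by rewrite mulr1 le_max fM//; exact: set_mem.
Qed.

Lemma exists_ge_exp A f : measurable A -> mu A = 1%E -> bmeas f ->
  exists2 x, A x & \int[mu]_x f x <= f x.
Proof.
move=> mA A1 bf; apply: contrapT => noex.
set e := \int[mu]_x f x in noex.
have ltA x : A x -> f x < e.
  by move=> Ax; rewrite ltNge; apply/negP => ex; apply: noex; exists x.
have bA := bmeas_indic mA (R := R).
pose g x := (e - f x) * \1_A x.
have bg : bmeas g by rewrite /g; bmeas.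
have g0 x : 0 <= g x.
  rewrite /g indicE; have [xA|_] := boolP (x \in A); last by rewrite mulr0.
  by rewrite mulr1 subr_ge0 ltW// ltA//; exact: set_mem.
have Ig : \int[mu]_x g x = 0.
  rewrite -(@ae_eq_exp _ _ _ _ _ (fun x => e - f x) _ mA A1); [|by bmeas|by []|].
    by rewrite expB; [rewrite exp_cst subrr|bmeas|bmeas].
  by move=> x Ax; rewrite /g indicE mem_set// mulr1.
have := exp_eq0_ae bg g0 Ig; set Z := [set x | _] => Z1.
have ZA : Z `<=` ~` A.
  move=> x; rewrite /Z/= /g => gx Ax; move: gx.
  rewrite indicE mem_set// mulr1 => /eqP; rewrite subr_eq0 => /eqP ex.
  by have := ltA _ Ax; rewrite -ex ltxx.
have mZ : measurable Z.
  exact: measurable_zeros.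
have : (mu Z <= mu (~` A))%E.
  by apply: le_measure => //; apply: mem_set => //; exact: measurableC.
by rewrite Z1 probability_setC// A1 subee// leNgt lte01.
Qed.

Lemma bmeas_Lfun f : bmeas f -> f \in Lfun mu 2%:E.
Proof.
move=> bf; have [mf _] := bf.
rewrite inE; apply/andP; split; first by rewrite inE.
rewrite inE/= /finite_norm (Lnorm2_EFin (f := f))//; first exact: ltry.
- exact/measurable_EFinP.
- by apply: (ae_eq_full measurableT); [exact: probability_setT|].
Qed.

Lemma Lfun_add_bmeas f g : f \in Lfun mu 2%:E -> bmeas g ->
  (fun x => f x + g x) \in Lfun mu 2%:E.
Proof.
move=> fL bg; have le12 : (1 <= 2%:E :> \bar R)%E by rewrite lee_fin ler1n.
have [_ addL] := Lfun_addr_closed mu le12.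
exact: addL fL (bmeas_Lfun bg).
Qed.

Lemma Lfun_measurable f : f \in Lfun mu 2%:E -> measurable_fun setT f.
Proof. by rewrite inE => /andP[+ _]; rewrite inE. Qed.

Lemma measure_setI_full A A' : measurable A -> measurable A' -> mu A' = 1%E ->
  mu (A `&` A') = mu A.
Proof.
move=> mA mA' A'1.
have mAC : measurable (A `&` ~` A') by apply: measurableI => //; exact: measurableC.
have -> : mu A = (mu (A `&` A') + mu (A `&` ~` A'))%E.
  rewrite -measureU//; last by rewrite setIACA setICr setI0.
    by rewrite -setIUr setUCr setIT.
  exact: measurableI.
rewrite [X in (_ + X)%E](_ : _ = 0%E) ?adde0//.
apply/eqP; rewrite eq_le measure_ge0 andbT.
apply: (@le_trans _ _ (mu (~` A'))).
  apply: le_measure; [exact: mem_set|apply: mem_set|exact: subIsetr].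
  exact: measurableC.
by rewrite probability_setC// A'1 subee.
Qed.

Lemma full_setI A A' : measurable A -> measurable A' -> mu A = 1%E ->
  mu A' = 1%E -> mu (A `&` A') = 1%E.
Proof. by move=> mA mA' A1 A'1; rewrite measure_setI_full. Qed.

End restriction.

Section transfer.
Context {R : realType} {n : nat}.
Notation V := 'rV[R]_n.
Variables (P Q : probability V R) (c : V -> V -> R) (eps : R).
Variables (Om Om' : set V) (f g : V -> R).
Hypotheses (mOm : measurable Om) (P1 : P Om = 1%E).
Hypotheses (mOm' : measurable Om') (Q1 : Q Om' = 1%E).
Hypothesis mc : measurable_fun setT (fun z : V * V => c z.1 z.2).
Hypotheses (mf : measurable_fun setT f) (mg : measurable_fun setT g).

Let mOO : measurable (Om `*` Om'). Proof. exact: measurableX. Qed.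
Let OO1 : pprod P Q (Om `*` Om') = 1%E. Proof. exact: pprod_setX. Qed.

Lemma measurable_oplus : measurable_fun setT (oplus f g).
Proof.
by apply: measurable_funD; [exact: (measurableT_comp mf measurable_fst)|
  exact: (measurableT_comp mg measurable_snd)].
Qed.

Let moplus := measurable_oplus.

Let mF : measurable_fun setT (fun z : V * V => Num.max (oplus f g z - c z.1 z.2) 0).
Proof. by apply: measurable_maxr => //; exact: measurable_funB. Qed.

(** The dual objective only depends on the values on Om * Om'. *)
Lemma dual_obj_dualR (s F : V * V -> R) : bmeas s -> bmeas F ->
    (forall z, Om z.1 -> Om' z.2 -> oplus f g z = s z) ->
    (forall z, Om z.1 -> Om' z.2 -> oplus f g z - c z.1 z.2 = F z) ->
  dual_obj P Q c eps f g = (dualR P Q eps s F)%:E.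
Proof.
move=> bs bF sE FE; rewrite /dualR -bmeas_EFin; last by bmeas.
apply: ae_eq_integral => //.
- apply/measurable_EFinP; apply: measurable_funB => //.
  by apply: measurable_funM => //; exact: measurable_funX.
- apply/measurable_EFinP.
  by have [] : bmeas (fun z =>
    s z - (2 * eps)^-1 * Num.max (F z) 0 ^+ 2) by bmeas.
- apply: (ae_eq_full (mu := pprod P Q) mOO OO1) => -[x y] [/= Ox Oy].
  by have := FE (x, y) Ox Oy; have := sE (x, y) Ox Oy; rewrite /= => <- <-.
Qed.

Variable F : V * V -> R.
Hypothesis bF : bmeas F.
Hypothesis FE : forall z, Om z.1 -> Om' z.2 -> oplus f g z - c z.1 z.2 = F z.

Let D1_grad1 x : Om x -> D1 Q c eps f g x = grad1 Q eps F x.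
Proof.
move=> Ox; rewrite /D1 /grad1; congr (_ - _ * fine _).
apply: ae_eq_integral => //.
- apply/measurable_EFinP; exact: (measurableT_comp mF (measurable_pair1 x)).
- apply/measurable_EFinP.
  by have [] : bmeas (fun y => Num.max (F (x, y)) 0) by bmeas.
- by apply: (ae_eq_full mOm' Q1) => y Oy; rewrite -FE.
Qed.

Let D2_grad2 y : Om' y -> D2 P c eps f g y = grad2 P eps F y.
Proof.
move=> Oy; rewrite /D2 /grad2; congr (_ - _ * fine _).
apply: ae_eq_integral => //.
- apply/measurable_EFinP; exact: (measurableT_comp mF (measurable_pair2 y)).
- apply/measurable_EFinP.
  by have [] : bmeas (fun x => Num.max (F (x, y)) 0) by bmeas.
- by apply: (ae_eq_full mOm P1) => x Ox; rewrite -FE.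
Qed.

Let mmaxE : measurable_fun setT
  (fun z : V * V => (Num.max (oplus f g z - c z.1 z.2) 0)%:E).
Proof. exact/measurable_EFinP. Qed.

Let maxE0 (z : V * V) : (0 <= (Num.max (oplus f g z - c z.1 z.2) 0)%:E)%E.
Proof. by rewrite lee_fin le_max lexx orbT. Qed.

Let measurable_D1 : measurable_fun setT (D1 Q c eps f g).
Proof.
apply: measurable_funB => //; apply: measurable_funM => //.
apply: (@measurableT_comp _ _ _ _ _ _ fine) => //.
exact: (@measurable_fun_fubini_tonelli_F _ _ V V R Q
  (fun z => (Num.max (oplus f g z - c z.1 z.2) 0)%:E)).
Qed.

Let measurable_D2 : measurable_fun setT (D2 P c eps f g).
Proof.
apply: measurable_funB => //; apply: measurable_funM => //.
apply: (@measurableT_comp _ _ _ _ _ _ fine) => //.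
exact: (@measurable_fun_fubini_tonelli_G _ _ V V R P
  (fun z => (Num.max (oplus f g z - c z.1 z.2) 0)%:E)).
Qed.

Lemma grad_normE : grad_norm P Q c eps f g =
  (Num.sqrt (\int[P]_x (grad1 Q eps F x ^+ 2) +
             \int[Q]_y (grad2 P eps F y ^+ 2)))%:E.
Proof.
have b1 := bmeas_grad1 P Q eps bF; have b2 := bmeas_grad2 P Q eps bF.
rewrite /grad_norm (Lnorm2_EFin (f := grad1 Q eps F))//; last 2 first.
- exact/measurable_EFinP.
- by apply: (ae_eq_full mOm P1) => x Ox; rewrite /= D1_grad1.
rewrite (Lnorm2_EFin (f := grad2 P eps F))//; last 2 first.
- exact/measurable_EFinP.
- by apply: (ae_eq_full mOm' Q1) => y Oy; rewrite /= D2_grad2.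
have ge0 (mu : probability V R) (D : V -> R) :
  0 <= \int[mu]_x (D x ^+ 2) by apply: exp_ge0 => x; exact: sqr_ge0.
by rewrite -!EFin_expe !sqr_sqrtr.
Qed.

End transfer.

(** * The error bound and the Polyak-Lojasiewicz inequality *)

Unset Implicit Arguments.

Theorem theorem2p5 (R : realType) (d : nat) (hd : (1 <= d)%N)
  (eps : R) (heps : 0 < eps)
  (P Q : probability 'rV[R]_d R)
  (Omega Omega' : set 'rV[R]_d)
  (suppP : is_support P Omega)
  (convexOmega : convex_set Omega) (compactOmega : compact Omega)
  (rho : 'rV[R]_d -> R) (rho_density : is_lebesgue_density P rho)
  (lambdaP LambdaP : R) (hlambdaP : 0 < lambdaP) (hLambdaP : lambdaP < LambdaP)
  (rho_bounds : forall x, Omega x -> lambdaP <= rho x <= LambdaP)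
  (suppQ : is_support Q Omega') (compactOmega' : compact Omega')
  (L : R) (hL : 0 < L)
  (c : 'rV[R]_d -> 'rV[R]_d -> R) (c_lipschitz : elipschitz2 L c)
  (deltaP : R) (hdeltaP : 0 < deltaP <= 1)
  (deltaP_ball : forall (r : R) x, 0 < r -> Omega x ->
    ((deltaP * Num.min (r ^+ d) 1)%:E <= P (eball x r))%E)
  (fs gs : 'rV[R]_d -> R)
  (potentials : is_dual_maximizer P Q c eps fs gs)
  (fs_lipschitz : elipschitz_on Omega L fs)
  (gs_lipschitz : elipschitz_on Omega' L gs)
  (f g : 'rV[R]_d -> R)
  (f_bounded : bounded_measurable_on Omega f)
  (g_bounded : bounded_measurable_on Omega' g) :
  let h := oplus f g \- oplus fs gs in
  let gammaE := gamma Q eps L lambdaP LambdaP deltaP Omega Omega' in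
  let M := Num.max (sup_norm2 Omega Omega' h) eps in
  ('N[prod_prob P Q]_2%:E[EFin \o h]
     <= (gammaE * M)%:E * grad_norm P Q c eps f g)%E
  /\
  ((gammaE * M)^-1%:E * (QOT P Q c eps - dual_obj P Q c eps f g)
     <= grad_norm P Q c eps f g ^+ 2)%E.
Proof.
move=> h0 gammaE M.
have [mOm mOm'] := (support_measurable suppP, support_measurable suppQ).
have [P1 Q1] : P Omega = 1%E /\ Q Omega' = 1%E by case: suppP; case: suppQ.
have [x0 Ox0] := support_nonempty suppP.
have [y0 Oy0] := support_nonempty suppQ.
have mc := measurable_elipschitz2 hL c_lipschitz.
have [mf fb] := f_bounded; have [mg gb] := g_bounded.
have [fsL gsL smax] := potentials.
have [mfs mgs] := (Lfun_measurable fsL, Lfun_measurable gsL).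
have fsb := elipschitz_bounded hL compactOmega fs_lipschitz.
have gsb := elipschitz_bounded hL compactOmega' gs_lipschitz.
pose OO : set ('rV[R]_d * 'rV[R]_d) := Omega `*` Omega'.
have mOO : measurable OO by exact: measurableX.
have OO1 : pprod P Q OO = 1%E by exact: pprod_setX.
have cb : exists B : R, forall z, OO z -> `|c z.1 z.2| <= B.
  exists (`|c x0 y0| + L * (ediam Omega + ediam Omega')) => -[x y] [/= Ox Oy].
  rewrite -[c x y](subrK (c x0 y0)) addrC (le_trans (ler_normD _ _))// lerD2l.
  rewrite (le_trans (c_lipschitz _ _ _ _))//; apply: ler_wpM2l; first exact: ltW.
  rewrite (le_trans (sqrt_sum_sqr_le (enorm_ge0 _) (enorm_ge0 _)))//.
  by rewrite lerD// enorm_ediam.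
pose f1 := restr0 Omega f; pose g1 := restr0 Omega' g.
pose a := restr0 Omega fs; pose b := restr0 Omega' gs.
pose c1 := restr0 OO (fun z => c z.1 z.2).
have bf1 : bmeas f1 by exact: bmeas_restr0.
have bg1 : bmeas g1 by exact: bmeas_restr0.
have ba : bmeas a by exact: bmeas_restr0.
have bb : bmeas b by exact: bmeas_restr0.
have bc1 : bmeas c1 by exact: bmeas_restr0.
pose s (z : 'rV[R]_d * 'rV[R]_d) := a z.1 + b z.2.
pose xi z := s z - c1 z.
pose u x := f1 x - a x; pose v y := g1 y - b y.
pose h z := u z.1 + v z.2.
have bu : bmeas u by rewrite /u; bmeas.
have bv : bmeas v by rewrite /v; bmeas.
have bs : bmeas s by rewrite /s; bmeas.
have bxi : bmeas xi by rewrite /xi; bmeas.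
have bh : bmeas h by rewrite /h; bmeas.
pose F z := xi z + h z.
have bF : bmeas F by rewrite /F; bmeas.
have sE z : Omega z.1 -> Omega' z.2 -> s z = oplus fs gs z.
  by move=> Ox Oy; rewrite /s /a /b !restr0E.
have xiE z : Omega z.1 -> Omega' z.2 -> xi z = oplus fs gs z - c z.1 z.2.
  by move=> Ox Oy; rewrite /xi sE// /c1 restr0E//; split.
have hE z : Omega z.1 -> Omega' z.2 -> h z = h0 z.
  move=> Ox Oy; rewrite /h /u /v /f1 /g1 /a /b !restr0E// /h0 /oplus/=; ring.
(* The gradient vanishes at the potentials: perturb one of them by a bounded
   function, which preserves square integrability. *)
have grad1_xi : P [set x | grad1 Q eps xi x = 0] = 1%E.
  apply: (grad1_eq0 heps bs bxi) => w bw; rewrite -lee_fin.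
  have mw : measurable_fun setT (fun x => fs x + w x).
    by apply: measurable_funD => //; case: bw.
  have wL : (fun x => fs x + w x) \in Lfun P 2%:E.
    exact: Lfun_add_bmeas.
  have := smax _ _ wL gsL.
  rewrite (dual_obj_dualR (s := fun z => s z + w z.1) (F := fun z => xi z + w z.1)
    eps mOm P1 mOm' Q1 mc mw mgs); [|by bmeas|by bmeas| |].
  - rewrite (dual_obj_dualR (s := s) (F := xi) eps mOm P1 mOm' Q1 mc mfs mgs)//.
      by move=> z Ox Oy; rewrite sE.
    by move=> z Ox Oy; rewrite xiE.
  - by move=> z Ox Oy; rewrite sE// /oplus; ring.
  - by move=> z Ox Oy; rewrite xiE// /oplus; ring.
have grad2_xi : Q [set y | grad2 P eps xi y = 0] = 1%E.
  apply: (grad2_eq0 heps bs bxi) => w bw; rewrite -lee_fin.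
  have mw : measurable_fun setT (fun x => gs x + w x).
    by apply: measurable_funD => //; case: bw.
  have wL : (fun x => gs x + w x) \in Lfun Q 2%:E.
    exact: Lfun_add_bmeas.
  have := smax _ _ fsL wL.
  rewrite (dual_obj_dualR (s := fun z => s z + w z.2) (F := fun z => xi z + w z.2)
    eps mOm P1 mOm' Q1 mc mfs mw); [|by bmeas|by bmeas| |].
  - rewrite (dual_obj_dualR (s := s) (F := xi) eps mOm P1 mOm' Q1 mc mfs mgs)//.
      by move=> z Ox Oy; rewrite sE.
    by move=> z Ox Oy; rewrite xiE.
  - by move=> z Ox Oy; rewrite sE// /oplus; ring.
  - by move=> z Ox Oy; rewrite xiE// /oplus; ring.
(* When both variables move by at most r, xi changes by at most eps / 2. *)
pose r := eps / (8 * L).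
have r0 : 0 < r by rewrite divr_gt0// mulr_gt0.
pose q := inf [set fine (Q (eball y r)) | y in Omega'].
have q0 : 0 < q := inf_mass_gt0 suppQ compactOmega' r0.
have q1 : q <= 1 := inf_mass_le1 suppQ r.
have qle y : Omega' y -> (q%:E <= Q (eball y r))%E := @inf_mass_le _ _ Q Omega' r y.
pose p := deltaP * Num.min (r ^+ d) 1.
have [dP0 dP1] := andP hdeltaP.
have p0 : 0 < p by rewrite mulr_gt0// lt_min exprn_gt0//=.
have p1 : p <= 1.
  by rewrite -[leRHS]mulr1 ler_pM ?le_min ?exprn_ge0 ?ge_min ?lexx ?orbT// ltW.
pose N := `|Num.ceil (8 * L * ediam Omega / eps)|%N.
have dia0 : 0 < ediam Omega := ediam_gt0 suppP compactOmega hd rho_density.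
have X0 : 0 < 8 * L * ediam Omega / eps by rewrite divr_gt0// !mulr_gt0.
have ceil0 : 0 < Num.ceil (8 * L * ediam Omega / eps) by rewrite ceil_gt0.
have NE : (Num.ceil (8 * L * ediam Omega / eps))%:~R = N%:R :> R.
  by rewrite -[in LHS](gtz0_abs ceil0).
have N0 : (0 < N)%N by rewrite /N absz_gt0 gt_eqF.
have DN : ediam Omega <= N%:R * r.
  have := ceil_ge (8 * L * ediam Omega / eps); rewrite NE /r.
  rewrite -(ler_pM2r r0) /r => /(le_trans _); apply.
  rewrite le_eqVlt; apply/orP; left; apply/eqP; field.
  by rewrite !gt_eqF.
pose K := LambdaP ^+ 2 / lambdaP ^+ 2 * N%:R ^+ (d + 2).
have K1 : 1 <= K.
  apply: mulr_ege1; last by rewrite exprn_ege1// ler1n.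
  have L0 : 0 < LambdaP by apply: lt_trans hLambdaP.
  rewrite ler_pdivlMr ?exprn_gt0// mul1r; apply: lerXn2r; last exact: ltW.
    by rewrite nnegrE ltW.
  by rewrite nnegrE ltW.
(* The region where the weight of the growth inequality is 1. *)
pose A : set ('rV[R]_d * 'rV[R]_d) := OO `&` [set z | eps / 2 <= xi z].
have mA : measurable A.
  apply: measurableI => //; have [mxi _] := bxi.
  have -> : [set z | eps / 2 <= xi z] = xi @^-1` `[eps / 2, +oo[.
    by apply/seteqP; split => z /=; rewrite in_itv/= andbT.
  by rewrite -[X in measurable X]setTI; exact: mxi.
have bA : bmeas (fun z => \1_A z : R) by exact: bmeas_indic.
have xi_lip x y x' y' : Omega x -> Omega' y -> Omega x' -> Omega' y' ->
    enorm (x' - x) <= r -> enorm (y' - y) <= r -> eps <= xi (x, y) ->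
    1 <= \1_A (x', y') :> R.
  move=> Ox Oy Ox' Oy' xr yr exi; rewrite indicE mem_set//; split => //=.
  move: exi; rewrite !xiE//= /oplus/=.
  have := fs_lipschitz _ _ Ox Ox'; have := gs_lipschitz _ _ Oy Oy'.
  have := c_lipschitz x' y' x y.
  rewrite (enormBC x x') (enormBC y y').
  have := sqrt_sum_sqr_le (enorm_ge0 (x' - x)) (enorm_ge0 (y' - y)).
  move: (enorm _) (enorm _) (Num.sqrt _) xr yr => i j k xr yr kij.
  have k2 : L * k <= L * (r + r) by apply: ler_wpM2l; lra.
  have i2 : L * i <= L * r by apply: ler_wpM2l; lra.
  have j2 : L * j <= L * r by apply: ler_wpM2l; lra.
  have Lr : L * r = eps / 8 by rewrite /r; field; rewrite gt_eqF.
  rewrite !ler_norml => /andP[? ?] /andP[? ?] /andP[? ?]; lra.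
pose G := Omega `&` [set x | grad1 Q eps xi x = 0].
pose G' := Omega' `&` [set y | grad2 P eps xi y = 0].
have bg1' := bmeas_grad1 P Q eps bxi; have bg2' := bmeas_grad2 P Q eps bxi.
have mG : measurable G by apply: measurableI => //; exact: (measurable_zeros bg1').
have mG' : measurable G' by apply: measurableI => //; exact: (measurable_zeros bg2').
have G1 : P G = 1%E by apply: full_setI => //; exact: (measurable_zeros bg1').
have G'1 : Q G' = 1%E by apply: full_setI => //; exact: (measurable_zeros bg2').
have max_ge t : eps <= Num.max t 0 -> eps <= t.
  by rewrite le_max => /orP[//|]; rewrite leNgt heps.
(* A function of mean eps takes a value at least eps on the support. *)
have Gy x : G x -> exists2 y, Omega' y & eps <= xi (x, y).
  move=> [Ox gx].
  have bm : bmeas (fun y => Num.max (xi (x, y)) 0) by bmeas.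
  have [y Oy le_y] := exists_ge_exp mOm' Q1 bm; exists y => //; apply: max_ge.
  apply: le_trans le_y; move: gx => /=; rewrite /grad1 => /eqP.
  rewrite subr_eq0 => /eqP ge; rewrite -(@ler_pM2l _ eps^-1) ?invr_gt0// -ge.
  by rewrite mulVf// gt_eqF.
have Gx y : G' y -> exists2 x, Omega x & eps <= xi (x, y).
  move=> [Oy gy].
  have bm : bmeas (fun x => Num.max (xi (x, y)) 0) by bmeas.
  have [x Ox le_x] := exists_ge_exp mOm P1 bm; exists x => //; apply: max_ge.
  apply: le_trans le_x; move: gy => /=; rewrite /grad2 => /eqP.
  rewrite subr_eq0 => /eqP ge; rewrite -(@ler_pM2l _ eps^-1) ?invr_gt0// -ge.
  by rewrite mulVf// gt_eqF.
have enorm0 : enorm (0 : 'rV[R]_d) = 0.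
  by rewrite -(scale0r (0 : 'rV[R]_d)) enormZ normr0 mul0r.
have poincare : p * q * \int[pprod P Q]_z (h z ^+ 2) <=
    8 * K * \int[pprod P Q]_z (\1_A z * h z ^+ 2).
  (* The inequality requires u to be centred, while h is unchanged by moving a
     constant from u to v. *)
  pose m := \int[P]_x u x.
  have bu' : bmeas (fun x => u x - m) by bmeas.
  have bv' : bmeas (fun y => v y + m) by bmeas.
  have hh z : (u z.1 - m) + (v z.2 + m) = h z by rewrite /h; ring.
  have bS : bmeas (fun z => \1_(near_pairs Omega r) z : R).
    by apply: bmeas_indic; exact: measurable_near_pairs.
  have indic_ge0 (z : 'rV[R]_d * 'rV[R]_d) : 0 <= \1_A z :> R.
    by rewrite indicE; case: (_ \in _).
  have S01 z : \1_(near_pairs Omega r) z = 0 :> R \/ \1_(near_pairs Omega r) z = 1 :> R.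
    by rewrite indicE; case: (_ \in _); [right|left].
  have near1 x x' : \1_(near_pairs Omega r) (x, x') = 1 :> R ->
      [/\ Omega x, Omega x' & enorm (x - x') <= r].
    rewrite indicE; have [/set_mem//|_ /eqP] := boolP ((x, x') \in _).
    by rewrite eq_sym oner_eq0.
  have centred : \int[P]_x (u x - m) = 0 by rewrite expB ?exp_cst ?subrr//; bmeas.
  have -> : \int[pprod P Q]_z (h z ^+ 2) =
      \int[pprod P Q]_z (((u z.1 - m) + (v z.2 + m)) ^+ 2).
    by apply: eq_exp => z; rewrite hh.
  have -> : \int[pprod P Q]_z (\1_A z * h z ^+ 2) =
      \int[pprod P Q]_z (\1_A z * ((u z.1 - m) + (v z.2 + m)) ^+ 2).
    by apply: eq_exp => z; rewrite hh.
  apply: (@additive_poincare _ _ _ _ _ P Q (fun x => u x - m) (fun y => v y + m)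
    (fun z => \1_A z) bu' bv' bA indic_ge0
    (fun z => \1_(near_pairs Omega r) z) G G' p q K) => //.
  - by rewrite ltW.
  - by rewrite ltW.
  - move=> x x' Gx' /near1[Ox Ox' xx'].
    have [y Oy exi] := Gy _ Gx'.
    exists (eball y r `&` Omega'); split.
    + by apply: measurableI => //; exact: measurable_eball.
    + by rewrite measure_setI_full//; [exact: qle|exact: measurable_eball].
    + move=> y' [/ltW yy' Oy']; split.
        by apply: xi_lip exi => //; rewrite subrr enorm0 ltW.
      by apply: xi_lip exi => //; rewrite enormBC.
  - move=> y Gy'; have [Oy _] := Gy'.
    have [x Ox exi] := Gx _ Gy'.
    exists (eball x r `&` Omega); split.
    + by apply: measurableI => //; exact: measurable_eball.
    + by rewrite measure_setI_full//; [exact: deltaP_ball|exact: measurable_eball].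
    + move=> x' [/ltW xx' Ox'].
      by apply: xi_lip exi => //; rewrite subrr enorm0 ltW.
  - exact: (chaining mOm P1 rho_density hlambdaP hLambdaP rho_bounds N0 DN
      convexOmega (fun x y Ox Oy => enorm_ediam compactOmega Ox Oy) bu').
have eM : eps <= M by rewrite /M le_max lexx orbT.
have hM z : OO z -> `|h z| <= M.
  move=> [Ox Oy]; rewrite /M le_max; apply/orP; left.
  have [_ [B hB]] := bh.
  apply: ub_le_sup; last by exists z; [split|rewrite hE].
  by exists B => _ [z' [Ox' Oy'] <-]; rewrite -hE.
have AP z : \1_A z = 0 :> R \/ [/\ \1_A z = 1 :> R, eps / 2 <= xi z & `|h z| <= M].
  rewrite indicE; have [/set_mem[Oz xiz]|_] := boolP (z \in A); last by left.
  by right; split => //; exact: hM.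
have pq0 : 0 < p * q by rewrite mulr_gt0.
pose C := 8 * K / (p * q).
have C0 : 0 <= C.
  by apply: divr_ge0; [apply: mulr_ge0 => //; exact: le_trans K1|exact: ltW].
have hC : \int[pprod P Q]_z (h z ^+ 2) <= C * \int[pprod P Q]_z (\1_A z * h z ^+ 2).
  by rewrite /C mulrAC ler_pdivlMr// mulrC.
have gammaC : gammaE = 2 * C.
  have pV : p^-1 = deltaP^-1 * Num.max (8 * L / eps) 1 ^+ d.
    rewrite /p invfM -(invf_div eps) -/r; congr (_ * _).
    have [r1|/ltW r1] := lerP r 1.
      have rd : r ^+ d <= 1 by rewrite exprn_ile1// ltW.
      have r1' : 1 <= r^-1 by rewrite invf_ge1.
      by rewrite (min_l rd) (max_l r1') exprVn.
    have rd : 1 <= r ^+ d by rewrite exprn_ege1.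
    have r1' : r^-1 <= 1 by rewrite invf_le1.
    by rewrite (min_r rd) (max_r r1') expr1n invr1.
  by rewrite /C (invfM p q) /gammaE /gamma NE -/q -pV /K; ring.
have [] := @abstract_error_bound _ _ _ _ _ P Q eps heps xi (fun z => \1_A z) u v
  bxi bA bu bv grad1_xi grad2_xi M C eM C0 AP hC.
rewrite -gammaC; set g2 := \int[P]_x _ + _ => bound gap.
have g20 : 0 <= g2 by apply: addr_ge0; apply: exp_ge0 => ?; exact: sqr_ge0.
have M0 : 0 < M by apply: lt_le_trans eM.
have gM0 : 0 < gammaE * M.
  rewrite gammaC mulr_gt0// mulr_gt0// divr_gt0// mulr_gt0//.
  exact: lt_le_trans K1.
have FE z : Omega z.1 -> Omega' z.2 -> oplus f g z - c z.1 z.2 = F z.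
  by move=> Ox Oy; rewrite /F hE// xiE// /h0 /=; ring.
rewrite (grad_normE eps mOm P1 mOm' Q1 mc mf mg bF FE).
split.
  rewrite (Lnorm2_EFin (mu := prod_prob P Q) (f := h))//; last 2 first.
  - apply/measurable_EFinP.
    apply: measurable_funB; first exact: (measurable_oplus mf mg).
    exact: (measurable_oplus mfs mgs).
  - by apply: (ae_eq_full (mu := pprod P Q) mOO OO1) => z [Ox Oy]; rewrite /= hE.
  rewrite -EFinM lee_fin -[gammaE * M]ger0_norm; last exact: ltW.
  rewrite -sqrtr_sqr -sqrtrM ?sqr_ge0//; exact: ler_wsqrtr.
rewrite -EFin_expe sqr_sqrtr// lee_pdivrMl//.
rewrite (dual_obj_dualR (s := fun z => s z + h z) (F := F) 
  eps mOm P1 mOm' Q1 mc mf mg)//; last 2 first.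
- by bmeas.
- by move=> z Ox Oy; rewrite hE// sE// /h0/=; ring.
apply: (@le_trans _ _ ((dualR P Q eps s xi)%:E -
  (dualR P Q eps (fun z => s z + h z) F)%:E)%E).
  apply: leeB => //; apply: (QOT_le_dualR heps ba bb bc1 mc mOO OO1) => //.
  by move=> z Oz; rewrite /c1 restr0E.
rewrite -EFinB -EFinM lee_fin.
apply: le_trans (dualR_concave P Q heps bs bxi bh) _.
exact: gap.
Qed.
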